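(* Let $R$ be an iterated local skew power series ring in the ordered list of variables $x_1,\dots,x_n$ of type (A) or (B), and let $\preceq$ be a monomial order on $R$. Let $F=(f_1,\dots,f_s)$ be an ordered tuple of nonzero elements of $R$. Define subsets of $\mathbb{N}^n$ by $$\Delta_{F,r}=(\mathrm{LM}(f_r)+\mathbb{N}^n)\setminus\bigcup_{i=1}^{r-1}\Delta_{F,i}\quad(1\le r\le s),\qquad \overline{\Delta}_F=\mathbb{N}^n\setminus\bigcup_{i=1}^s\Delta_{F,i}.$$ Then every $f\in R$ can be written uniquely as $f=q_1f_1+\dots+q_sf_s+r$, where $q_1,\dots,q_s,r\in R$ satisfy $\mathrm{supp}(q_i)+\mathrm{LM}(f_i)\subseteq\Delta_{F,i}$ for all $1\le i\le s$, and $\mathrm{supp}(r)\subseteq\overline{\Delta}_F$. Moreover, $\mathrm{LM}(f)\preceq\mathrm{LM}(q_if_i)$ for all $1\le i\le s$.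
   Context: $\mathbb{N}$ contains $0$. A skew derivation on a ring $B$ is a pair $(\sigma,\delta)$ with $\sigma$ an automorphism of $B$ and $\delta:B\to B$ additive with $\delta(rs)=\delta(r)s+\sigma(r)\delta(s)$. If $(B,\mathfrak m)$ is a complete local ring, $(\sigma,\delta)$ is local if $\sigma(\mathfrak m^i)=\mathfrak m^i$ and $\delta(\mathfrak m^i)\subseteq\mathfrak m^{i+1}$ for all $i\ge 0$; then the skew power series ring $B[[x;\sigma,\delta]]$ exists: it is the left $B$-module of formal power series $\sum_j b_jx^j$ with the continuous multiplication extending $xr=\sigma(r)x+\delta(r)$ $(r\in B)$, and it is again complete local. If $A\subseteq B$ is a subring, $(\sigma,\delta)$ is $A$-linear if $\sigma(a)=a$ and $\delta(a)=0$ for all $a\in A$. The ring $R$ is one of the following. Case (A): $A=k$ is a finite field of characteristic $p$, $R_0=A$, and for $1\le i\le n$, $R_i=R_{i-1}[[x_i;\sigma_i,\delta_i]]$ with $(\sigma_i,\delta_i)$ a local, $A$-linear skew derivation on $R_{i-1}$. Put $R=R_n$. Case (B): $A$ is a (commutative) complete discrete valuation ring of characteristic $0$, not a field, with residue field $k$ a finite field of characteristic $p$; $x_1$ is a fixed uniformiser of $A$; $R_1=A$, and for $2\le i\le n$, $R_i=R_{i-1}[[x_i;\sigma_i,\delta_i]]$ with $(\sigma_i,\delta_i)$ a local, $A$-linear skew derivation on $R_{i-1}$. Put $R=R_n$. Let $\iota:k\to A$ be the unique multiplicative section of $A\to k$ (the identity in case (A)). For $\alpha\in\mathbb{N}^n$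 write $x^\alpha=x_1^{\alpha_1}\cdots x_n^{\alpha_n}$. Every $r\in R$ is uniquely $r=\sum_{\alpha\in\mathbb{N}^n}r_\alpha x^\alpha$ with $r_\alpha\in\iota(k)$; $\mathrm{supp}(r)=\{\alpha:r_\alpha\ne0\}$. An additive total order on $\mathbb{N}^n$ is a total order with $0\prec\alpha$ for all $\alpha\neq 0$, and $\alpha\prec\beta\Rightarrow\alpha+\gamma\prec\beta+\gamma$ (it is automatically a well-order). For $r\ne0$, $\mathrm{LM}(r)=\mathrm{LM}_\preceq(r)=\min_\preceq\mathrm{supp}(r)$; $\mathrm{LM}(0)=\infty$, with $\alpha\prec\infty$ for all $\alpha\in\mathbb{N}^n$. A monomial order on $R$ is an additive total order $\preceq$ with $\mathrm{LM}_\preceq(x^\alpha x^\beta)=\alpha+\beta$ for all $\alpha,\beta\in\mathbb{N}^n$. *)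

(* Defs.v *)
From HB Require Import structures.
From mathcomp Require Import all_boot all_order all_algebra.
From mathcomp Require Import boolp classical_sets.

Set Implicit Arguments.
Unset Strict Implicit.
Unset Printing Implicit Defensive.

Import GRing.Theory.
Local Open Scope classical_set_scope.
Local Open Scope ring_scope.

(** * Complete local rings *)

(* For a local ring this is its maximal ideal. *)
Definition nonunits (B : unitRingType) : set B :=
  [set b | b \isn't a GRing.unit].

Definition ideal (B : nzRingType) (I : set B) : Prop :=
  [/\ I 0, forall a b, I a -> I b -> I (a + b)
    & forall a b, I b -> I (a * b) /\ I (b * a)].

(* Additively generated by the products of i elements of I; I^0 is the ring. *)
Fixpoint ideal_pow (B : nzRingType) (I : set B) (i : nat) : set B :=
  if i is j.+1 then
    [set r | exists s : seq (B * B),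
       (forall u, u \in s -> I u.1 /\ ideal_pow I j u.2) /\
       r = \sum_(u <- s) u.1 * u.2]
  else setT.

Definition mpow (B : unitRingType) (i : nat) : set B :=
  ideal_pow (@nonunits B) i.
Arguments mpow B i : clear implicits.

Definition local_ring (B : unitRingType) : Prop := ideal (@nonunits B).

(* Separated and complete for the topology given by the powers of m. *)
Definition adically_complete (B : unitRingType) : Prop :=
  (forall b : B, (forall N, mpow B N b) -> b = 0) /\
  (forall u : nat -> B,
     (forall N, exists M, forall i j : nat,
        (M <= i)%N -> (M <= j)%N -> mpow B N (u i - u j)) ->
     exists l : B, forall N, exists M, forall i : nat,
        (M <= i)%N -> mpow B N (u i - l)).

Definition complete_local (B : unitRingType) : Prop :=
  local_ring B /\ adically_complete B.

(** * Complete discrete valuation rings *)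

Definition principal (A : idomainType) (a : A) : set A :=
  [set b | exists c, b = c * a].

Definition is_PID (A : idomainType) : Prop :=
  forall I : set A, ideal I -> exists a, I = principal a.

(* A discrete valuation ring that is not a field is a local PID having a
   nonzero nonunit. *)
Definition complete_dvr (A : idomainType) : Prop :=
  [/\ is_PID A, complete_local A & exists2 a : A, a != 0 & nonunits a].

Definition uniformiser (A : idomainType) (a : A) : Prop :=
  principal a = @nonunits A.

(* res identifies k with the residue field of A. *)
Definition residue_map (A : unitRingType) (k : fieldType)
    (res : {rmorphism A -> k}) : Prop :=
  (forall c, exists a, res a = c) /\ (forall a, res a = 0 <-> nonunits a).

Definition multiplicative_section (A : unitRingType) (k : fieldType)
    (res : A -> k) (tau : k -> A) : Prop :=
  (forall a b, tau (a * b) = tau a * tau b) /\ (forall a, res (tau a) = a).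

(** * Skew derivations and skew power series *)

Definition skew_derivation (B : nzRingType)
    (sigma : {rmorphism B -> B}) (delta : {additive B -> B}) : Prop :=
  bijective sigma /\
  forall r s, delta (r * s) = delta r * s + sigma r * delta s.

Definition local_skew_derivation (B : unitRingType)
    (sigma : {rmorphism B -> B}) (delta : {additive B -> B}) : Prop :=
  [/\ skew_derivation sigma delta,
      forall i, sigma @` mpow B i = mpow B i
    & forall i, delta @` mpow B i `<=` mpow B i.+1].

(* Linearity over the subring j(A). *)
Definition linear_over (A B : nzRingType) (j : A -> B)
    (sigma delta : B -> B) : Prop :=
  forall a, sigma (j a) = j a /\ delta (j a) = 0.

(* coef identifies S with sequences of coefficients in B: two elements are
   close when many of their coefficients are m-adically close. *)
Definition series_close (B S : unitRingType) (coef : S -> nat -> B)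
    (N : nat) (s t : S) : Prop :=
  forall j : nat, (j < N)%N -> mpow B N (coef s j - coef t j).

(* S = B[[x; sigma, delta]], with emb the inclusion of B: as a left B-module,
   S is the module of formal power series \sum_j b_j x^j, and its
   multiplication is continuous for the product of the m-adic topologies and
   extends x r = sigma(r) x + delta(r).  Polynomials being dense in S, these
   clauses determine the ring S up to isomorphism. *)
Definition is_skew_power_series (B S : unitRingType)
    (sigma delta : B -> B) (emb : {rmorphism B -> S}) (x : S) : Prop :=
  exists coef : S -> nat -> B,
    [/\ (forall s t, (forall j, coef s j = coef t j) -> s = t) /\
        (forall c : nat -> B, exists s, forall j, coef s j = c j),
        forall b s t j, coef (emb b * s + t) j = b * coef s j + coef t j,
        forall i j, coef (x ^+ i) j = (j == i)%:R,
        forall r, x * emb r = emb (sigma r) * x + emb (delta r)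
      & forall s t N, exists M, forall s' t',
          series_close coef M s' s -> series_close coef M t' t ->
          series_close coef N (s' * t') (s * t)].

(** * Iterated local skew power series rings *)

(* iterated_skew xs0 j xs, with j : A -> R, says that R arises from A by
   finitely many steps R_i = R_{i-1}[[x_i; sigma_i, delta_i]]; j is the
   inclusion of A in R, and xs lists the images in R of the elements xs0 of A
   followed by the successive variables.  Starting from a complete local ring,
   every ring of the tower is complete local. *)
Inductive iterated_skew (A : unitRingType) (xs0 : seq A) :
    forall R : unitRingType, (A -> R) -> seq R -> Prop :=
| iterated_base : @iterated_skew A xs0 A (fun a => a) xs0
| iterated_step (B S : unitRingType) (j : A -> B) (xs : seq B)
    (sigma : {rmorphism B -> B}) (delta : {additive B -> B})
    (emb : {rmorphism B -> S}) (x : S) :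
    iterated_skew xs0 j xs ->
    local_skew_derivation sigma delta ->
    linear_over j sigma delta ->
    is_skew_power_series sigma delta emb x ->
    iterated_skew xs0 (fun a => emb (j a)) (rcons (map emb xs) x).

(* In both cases iota : k -> R is the multiplicative section k -> A followed by
   the inclusion of A in R. *)
Definition case_A (p : nat) (k : finFieldType) (R : unitRingType)
    (iota : k -> R) (xs : seq R) : Prop :=
  p \in [pchar k] /\ @iterated_skew k [::] R iota xs.

Definition case_B (p : nat) (k : finFieldType) (R : unitRingType)
    (iota : k -> R) (xs : seq R) : Prop :=
  exists (A : idomainType) (x1 : A) (res : {rmorphism A -> k})
         (tau : k -> A) (j : A -> R),
    [/\ p \in [pchar k], [pchar A] =i pred0 & complete_dvr A] /\
    [/\ uniformiser x1, residue_map res, multiplicative_section res tau,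
        iterated_skew [:: x1] j xs & iota = (fun c => j (tau c))].

(** * Supports and leading monomials *)

Notation mindex n := {ffun 'I_n -> nat}.

Definition monomial (n : nat) (R : nzRingType) (x : n.-tuple R)
    (alpha : mindex n) : R :=
  \prod_(i < n) tnth x i ^+ alpha i.

(* r = \sum_alpha c_alpha x^alpha with c_alpha in iota(k): unconditional
   convergence in the m-adic topology of R. *)
Definition expansion (n : nat) (k : Type) (R : unitRingType) (iota : k -> R)
    (x : n.-tuple R) (r : R) (c : mindex n -> R) : Prop :=
  (forall alpha, exists a, c alpha = iota a) /\
  forall N, exists s0 : seq (mindex n), forall s : seq (mindex n),
    uniq s -> {subset s0 <= s} ->
    mpow R N (r - \sum_(alpha <- s) c alpha * monomial x alpha).

Definition supp (n : nat) (k : Type) (R : unitRingType) (iota : k -> R)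
    (x : n.-tuple R) (r : R) : set (mindex n) :=
  [set alpha | exists2 c, expansion iota x r c & c alpha != 0].

Definition additive_total_order (n : nat) (le : rel (mindex n)) : Prop :=
  let lt (a b : mindex n) := (a != b) && le a b in
  [/\ [/\ reflexive le, antisymmetric le, transitive le & total le],
      forall a : mindex n, a != 0 -> lt 0 a
    & forall a b c : mindex n, lt a b -> lt (a + c) (b + c)].

Definition is_min (n : nat) (le : rel (mindex n)) (X : set (mindex n))
    (a : mindex n) : Prop :=
  X a /\ forall b, X b -> le a b.

(* None is the value infinity. *)
Definition LM (n : nat) (k : Type) (R : unitRingType) (iota : k -> R)
    (x : n.-tuple R) (le : rel (mindex n)) (r : R) : option (mindex n) :=
  xget None (Some @` is_min le (supp iota x r)).

Definition le_infty (n : nat) (le : rel (mindex n))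
    (a b : option (mindex n)) : bool :=
  match a, b with
  | _, None => true
  | None, Some _ => false
  | Some a', Some b' => le a' b'
  end.

Definition monomial_order (n : nat) (k : Type) (R : unitRingType)
    (iota : k -> R) (x : n.-tuple R) (le : rel (mindex n)) : Prop :=
  additive_total_order le /\
  forall a b, LM iota x le (monomial x a * monomial x b) = Some (a + b).

(** * The sets Delta *)

(* X + a, which is empty for a = infinity. *)
Definition shift (n : nat) (X : set (mindex n)) (a : option (mindex n)) :
    set (mindex n) :=
  [set g | exists b c, [/\ X b, a = Some c & g = b + c]].

(* The union of the Delta_i for i < r; here l i is LM(f_i), and the indices
   start at 0. *)
Fixpoint Delta_below (n : nat) (l : nat -> option (mindex n)) (r : nat) :
    set (mindex n) :=
  if r is i.+1 then
    Delta_below l i `|` (shift setT (l i) `\` Delta_below l i)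
  else set0.

Definition Delta (n : nat) (l : nat -> option (mindex n)) (r : nat) :
    set (mindex n) :=
  shift setT (l r) `\` Delta_below l r.

Lemma Delta_belowE (n : nat) (l : nat -> option (mindex n)) (r : nat) :
  Delta_below l r = \bigcup_(i in [set i | (i < r)%N]) Delta l i.
Proof.
elim: r => [|r IH]; first by rewrite predeqE => a; split=> // -[].
rewrite /= -/(Delta l r) IH predeqE => a; split.
- case=> [[i /= lti Di]|Dr]; last by exists r => /=.
  by exists i => //=; apply: ltnW.
- case=> i /=; rewrite ltnS leq_eqVlt => /orP[/eqP -> Dr|lti Di]; first by right.
  by left; exists i.
Qed.

Lemma DeltaE (n : nat) (l : nat -> option (mindex n)) (r : nat) :
  Delta l r =
  shift setT (l r) `\` \bigcup_(i in [set i | (i < r)%N]) Delta l i.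
Proof. by rewrite -Delta_belowE. Qed.

(** * Division *)

Definition Delta_F (n : nat) (k : Type) (R : unitRingType) (iota : k -> R)
    (x : n.-tuple R) (le : rel (mindex n)) (s : nat) (F : s.-tuple R)
    (i : nat) : set (mindex n) :=
  Delta (fun m => LM iota x le (nth 0 F m)) i.

Definition Delta_bar (n : nat) (k : Type) (R : unitRingType) (iota : k -> R)
    (x : n.-tuple R) (le : rel (mindex n)) (s : nat) (F : s.-tuple R) :
    set (mindex n) :=
  ~` \bigcup_(i in [set i | (i < s)%N]) Delta_F iota x le F i.

Definition is_division (n : nat) (k : Type) (R : unitRingType) (iota : k -> R)
    (x : n.-tuple R) (le : rel (mindex n)) (s : nat) (F : s.-tuple R) (f : R)
    (q : s.-tuple R) (r : R) : Prop :=
  [/\ f = \sum_(i < s) tnth q i * tnth F i + r,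
      forall i : 'I_s,
        shift (supp iota x (tnth q i)) (LM iota x le (tnth F i))
          `<=` Delta_F iota x le F i
    & supp iota x r `<=` Delta_bar iota x le F].

(* Main.v *)
(* Read every element of [R] through its digits in the finite field [k]. Division
   data (q_1, ..., q_s, r) with the prescribed supports are the same thing as one
   arbitrary family h of digits indexed by N^n, because the sets Delta_{F,i} and
   the remaining set partition N^n: h(alpha) is the digit of q_i at
   alpha - LM(f_i) on Delta_{F,i}, and the digit of r on the remaining set. Since
   leading monomials add up under multiplication, the digits of
   q_1 f_1 + ... + q_s f_s + r are triangular in h: those of h strictly below
   alpha being fixed, distinct values of h(alpha) give distinct digits at alpha.
   As the monomial order is a well-order, uniqueness follows by induction, and
   existence by recursion, because an injective map from the finite field [k] to
   itself is onto. No limit has to be taken in the division itself; the topology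
   only enters to show that leading monomials of series add up. *)
Require Import Defs.
From HB Require Import structures.
From mathcomp Require Import all_boot all_order all_algebra.
From mathcomp Require Import boolp classical_sets.

Set Implicit Arguments.
Unset Strict Implicit.
Unset Printing Implicit Defensive.

Import GRing.Theory.
Local Open Scope classical_set_scope.
Local Open Scope ring_scope.

(** * Skew power series over a complete local ring *)

Lemma mpowS (B : unitRingType) N :
  mpow B N.+1 = [set r | exists s : seq (B * B),
    (forall u, u \in s -> nonunits u.1 /\ mpow B N u.2) /\
    r = \sum_(u <- s) u.1 * u.2].
Proof. by []. Qed.

(** * Powers of the maximal ideal of a local ring *)

Section MaximalIdealPowers.
Variable B : unitRingType.
Hypothesis Bloc : local_ring B.

Lemma mpow_ideal N : ideal (mpow B N).
Proof.
case: Bloc => n0 nD nM.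
elim: N => [|N [I0 ID IM]]; first by split=> //; move=> a b _; split.
split.
- by exists [::]; rewrite big_nil.
- move=> _ _ [s [sI ->]] [t [tI ->]]; exists (s ++ t); rewrite big_cat; split=> // u.
  by rewrite mem_cat => /orP[/sI|/tI].
move=> a _ [s [sI ->]]; split.
- exists [seq (a * u.1, u.2) | u <- s]; rewrite big_map mulr_sumr; split.
    by move=> _ /mapP[u /sI[u1 u2] ->] /=; split=> //; case: (nM a _ u1).
  by apply: eq_bigr => u _; rewrite mulrA.
- exists [seq (u.1, u.2 * a) | u <- s]; rewrite big_map mulr_suml; split.
    by move=> _ /mapP[u /sI[u1 u2] ->] /=; split=> //; case: (IM a _ u2).
  by apply: eq_bigr => u _; rewrite mulrA.
Qed.

Lemma mpow0 N : mpow B N 0.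
Proof. by case: (mpow_ideal N). Qed.

Lemma mpowD N a b : mpow B N a -> mpow B N b -> mpow B N (a + b).
Proof. by case: (mpow_ideal N) => _ + _; apply. Qed.

Lemma mpowMl N a b : mpow B N b -> mpow B N (a * b).
Proof. by case: (mpow_ideal N) => _ _ IM /(IM a)[]. Qed.

Lemma mpowMr N a b : mpow B N b -> mpow B N (b * a).
Proof. by case: (mpow_ideal N) => _ _ IM /(IM a)[]. Qed.

Lemma mpowN N a : mpow B N a -> mpow B N (- a).
Proof. by rewrite -mulN1r; apply: mpowMl. Qed.

Lemma mpowB N a b : mpow B N a -> mpow B N b -> mpow B N (a - b).
Proof. by move=> Na /mpowN; apply: mpowD. Qed.

Lemma mpow_sum (I : eqType) N (s : seq I) (G : I -> B) :
  (forall i, i \in s -> mpow B N (G i)) -> mpow B N (\sum_(i <- s) G i).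
Proof.
move=> sG; rewrite big_seq; elim/big_rec: _ => [|i a /sG Gi Na].
  exact: mpow0.
exact: mpowD.
Qed.

Lemma mpowM M N a b : mpow B M a -> mpow B N b -> mpow B (M + N) (a * b).
Proof.
elim: M a => [|M IHM] a; first by move=> _; apply: mpowMl.
case=> s [sI ->] Nb; exists [seq (u.1, u.2 * b) | u <- s].
rewrite big_map mulr_suml; split.
  by move=> _ /mapP[u /sI[u1 u2] ->] /=; split=> //; apply: IHM.
by apply: eq_bigr => u _; rewrite mulrA.
Qed.

Lemma mpow1 : mpow B 1 = @nonunits B.
Proof.
case: Bloc => n0 nD nM; apply/seteqP; split=> a.
  case=> s [sI ->]; rewrite big_seq; elim/big_rec: _ => [//|u b /sI[u1 _]].
  by apply: nD; case: (nM u.2 _ u1).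
move=> na; exists [:: (a, 1)]; rewrite big_seq1 mulr1; split=> // u.
by rewrite inE => /eqP ->.
Qed.

Lemma mpow_leq M N a : (M <= N)%N -> mpow B N a -> mpow B M a.
Proof.
elim: M N a => [//|M IHM] [//|N] a leMN [s [sI ->]].
exists s; split=> // u /sI[u1 u2]; split=> //; exact: (IHM N).
Qed.

Lemma mpowX a N : nonunits a -> mpow B N (a ^+ N).
Proof.
move=> na; elim: N => // N IHN; rewrite exprS -add1n.
by apply: mpowM; rewrite ?mpow1.
Qed.

End MaximalIdealPowers.

(** * Coefficients, maximal ideal and completeness of B[[x; sigma, delta]] *)

Section SkewPowerSeries.
Variables (B S : unitRingType) (sigma : {rmorphism B -> B}).
Variables (delta : {additive B -> B}) (emb : {rmorphism B -> S}) (x : S).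
Variable coef : S -> nat -> B.
Hypothesis Bcl : complete_local B.
Hypothesis sd_local : local_skew_derivation sigma delta.
Hypothesis coef_inj : forall s t, (forall j, coef s j = coef t j) -> s = t.
Hypothesis coef_surj : forall c : nat -> B, exists s, forall j, coef s j = c j.
Hypothesis coef_lin :
  forall b s t j, coef (emb b * s + t) j = b * coef s j + coef t j.
Hypothesis coefXn : forall i j, coef (x ^+ i) j = (j == i)%:R.
Hypothesis skew_comm : forall r, x * emb r = emb (sigma r) * x + emb (delta r).
Hypothesis mul_cont : forall s t N, exists M, forall s' t',
  series_close coef M s' s -> series_close coef M t' t ->
  series_close coef N (s' * t') (s * t).

Let Bloc : local_ring B := proj1 Bcl.

Let Bsep a b : (forall N, mpow B N (a - b)) -> a = b.
Proof. by case: Bcl => _ [sep _] /sep/eqP; rewrite subr_eq0 => /eqP. Qed.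

Let sigma_mpow N a : mpow B N a -> mpow B N (sigma a).
Proof. by case: sd_local => _ sI _ Na; rewrite -[mpow B N]sI; exists a. Qed.

Let delta_mpow N a : mpow B N a -> mpow B N.+1 (delta a).
Proof. by case: sd_local => _ _ dI Na; apply: dI; exists a. Qed.

Lemma coefD s t j : coef (s + t) j = coef s j + coef t j.
Proof. by have := coef_lin 1 s t j; rewrite rmorph1 !mul1r. Qed.

Lemma coef0 j : coef 0 j = 0.
Proof.
by apply: (@addrI _ (coef 0 j)); rewrite -coefD !addr0.
Qed.

Lemma coefN s j : coef (- s) j = - coef s j.
Proof. by apply/eqP; rewrite -addr_eq0 -coefD addNr coef0. Qed.

Lemma coefB s t j : coef (s - t) j = coef s j - coef t j.
Proof. by rewrite coefD coefN. Qed.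

Lemma coef_embM b s j : coef (emb b * s) j = b * coef s j.
Proof. by have := coef_lin b s 0 j; rewrite coef0 !addr0. Qed.

Lemma coef_emb b j : coef (emb b) j = b *+ (j == 0%N).
Proof.
by rewrite -[emb b]mulr1 -(expr0 x) coef_embM coefXn; case: eqP; rewrite ?mulr1 ?mulr0.
Qed.

Lemma coef_sum (I : Type) (s : seq I) (G : I -> S) j :
  coef (\sum_(i <- s) G i) j = \sum_(i <- s) coef (G i) j.
Proof.
by elim/big_rec2: _ => [|i a b _ <-]; rewrite ?coef0 ?coefD.
Qed.

(** The skew relation computes products of polynomials only; products of series are reached from
    these truncations by continuity. *)
Definition trunc M s := \sum_(i < M) emb (coef s i) * x ^+ i.

Lemma coef_trunc M s j : coef (trunc M s) j = if (j < M)%N then coef s j else 0.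
Proof.
rewrite coef_sum; case: ifPn => [ltjM|geMj].
  rewrite (bigD1 (Ordinal ltjM)) //= coef_embM coefXn eqxx mulr1.
  rewrite big1 ?addr0 // => i; rewrite -val_eqE /= eq_sym => /negPf neij.
  by rewrite coef_embM coefXn neij mulr0.
rewrite big1 // => i _; rewrite coef_embM coefXn.
case: eqP => [ji|_]; last by rewrite mulr0.
by rewrite ji ltn_ord in geMj.
Qed.

Lemma trunc_close M s : series_close coef M (trunc M s) s.
Proof. by move=> j ltjM; rewrite coef_trunc ltjM subrr; apply: mpow0. Qed.

Lemma series_close_refl M s : series_close coef M s s.
Proof. by move=> j _; rewrite subrr; apply: mpow0. Qed.

Lemma series_close_leq M N s t :
  (M <= N)%N -> series_close coef N s t -> series_close coef M s t.
Proof.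
move=> leMN st j ltjM; apply: (mpow_leq leMN); apply: st.
exact: leq_trans leMN.
Qed.

(** The form in which continuity is used: to any given precision, either factor of a product may be
    replaced by a polynomial. *)
Lemma trunc_mul_close s t N : exists M, forall M', (M <= M')%N ->
  series_close coef N (trunc M' s * t) (s * t) /\
  series_close coef N (s * trunc M' t) (s * t).
Proof.
have [M cont] := mul_cont s t N; exists M => M' leMM'.
have tc u : series_close coef M (trunc M' u) u.
  by apply: series_close_leq leMM' _; apply: trunc_close.
by split; apply: cont => //; apply: series_close_refl.
Qed.

Lemma coef_mulx s j : coef (s * x) j = if j is i.+1 then coef s i else 0.
Proof.
(* Separatedness reduces the claim to congruences modulo m^N. Closeness at level [maxn N j.+1]
   covers the index [j] with precision at least [N], and truncation at [maxn M j] keeps the only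
   term that can contribute. *)
apply: Bsep => N; have [M /(_ (maxn M j) (leq_maxl _ _))[close _]] :=
  trunc_mul_close s x (maxn N j.+1).
have {close} := close j (leq_maxr _ _).
move/(mpow_leq (leq_maxl _ _))/(mpowN Bloc); rewrite opprB.
congr (mpow B N (_ - _)).
rewrite mulr_suml coef_sum.
under eq_bigr => i _ do rewrite -mulrA -exprSr coef_embM coefXn.
case: j => [|j]; first by rewrite big1 // => i _; rewrite mulr0.
have ltjM : (j < maxn M j.+1)%N by rewrite leq_maxr.
rewrite (bigD1 (Ordinal ltjM)) //= eqxx mulr1 big1 ?addr0 // => i.
rewrite -val_eqE /= eqSS eq_sym => /negPf ->; exact: mulr0.
Qed.

Lemma coef_mulXn s i j :
  coef (s * x ^+ i) j = if (i <= j)%N then coef s (j - i) else 0.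
Proof.
elim: i j => [|i IHi] j; first by rewrite mulr1 subn0.
by rewrite exprSr mulrA coef_mulx; case: j => [//|j]; rewrite IHi ltnS subSS.
Qed.

(** Coefficientwise form of x b x^i = sigma(b) x^(i+1) + delta(b) x^i, summed over the terms of a
    truncation and extended to series by continuity. *)
Lemma coef_xmul s j :
  coef (x * s) j = (if j is i.+1 then sigma (coef s i) else 0) + delta (coef s j).
Proof.
apply: Bsep => N; have [M /(_ (maxn M j.+1) (leq_maxl _ _))[_ close]] :=
  trunc_mul_close x s (maxn N j.+1).
have {close} := close j (leq_maxr _ _).
move/(mpow_leq (leq_maxl _ _))/(mpowN Bloc); rewrite opprB.
congr (mpow B N (_ - _)).
rewrite mulr_sumr.
under eq_bigr => i _ do
  rewrite mulrA skew_comm mulrDl -mulrA -exprS.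
rewrite big_split coefD !coef_sum; congr (_ + _).
  under eq_bigr => i _ do rewrite coef_embM coefXn.
  case: j => [|j]; first by rewrite big1 // => i _; rewrite mulr0.
  have ltjM : (j < maxn M j.+2)%N by rewrite ltnW ?leq_maxr.
  rewrite (bigD1 (Ordinal ltjM)) //= eqxx mulr1 big1 ?addr0 // => i.
  by rewrite -val_eqE /= eqSS eq_sym => /negPf ->; rewrite mulr0.
under eq_bigr => i _ do rewrite coef_embM coefXn.
have ltjM : (j < maxn M j.+1)%N by rewrite leq_maxr.
rewrite (bigD1 (Ordinal ltjM)) //= eqxx mulr1 big1 ?addr0 // => i.
by rewrite -val_eqE /= eq_sym => /negPf ->; rewrite mulr0.
Qed.

(** Such a [b] commutes with [x] by the skew relation, hence with polynomials, hence with series by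
    continuity. This makes the image of [iota] central at each step of the tower. *)
Lemma emb_central b : sigma b = b -> delta b = 0 -> (forall a, GRing.comm b a) ->
  forall s, GRing.comm (emb b) s.
Proof.
move=> sb db bC s; apply: coef_inj => j.
have xC i : GRing.comm (emb b) (x ^+ i).
  by apply: commrX; rewrite /GRing.comm skew_comm sb db rmorph0 addr0.
apply: Bsep => N; have [M /(_ (maxn M j.+1) (leq_maxl _ _))[close _]] :=
  trunc_mul_close s (emb b) (maxn N j.+1).
have {close} := close j (leq_maxr _ _).
move/(mpow_leq (leq_maxl _ _)); congr (mpow B N (_ - _)).
have -> : trunc (maxn M j.+1) s * emb b = emb b * trunc (maxn M j.+1) s.
  rewrite mulr_suml mulr_sumr; apply: eq_bigr => i _.
  by rewrite -mulrA -xC !mulrA -!rmorphM bC.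
by rewrite !coef_embM coef_trunc leq_maxr.
Qed.

(** Explicit candidate for the N-th power of the maximal ideal of [S]: since [x] lies in that ideal,
    the coefficient of x^j only has to lie in m^(N-j), with no condition once j >= N. *)
Definition coef_filter N : set S := [set s | forall j, mpow B (N - j) (coef s j)].

Lemma coef_filterD N s t :
  coef_filter N s -> coef_filter N t -> coef_filter N (s + t).
Proof. by move=> Ns Nt j; rewrite coefD; apply: mpowD. Qed.

Lemma coef_filterB N s t :
  coef_filter N s -> coef_filter N t -> coef_filter N (s - t).
Proof. by move=> Ns Nt j; rewrite coefB; apply: mpowB. Qed.

Lemma coef_filter0 N : coef_filter N 0.
Proof. by move=> j; rewrite coef0; apply: mpow0. Qed.

Lemma coef_filter_sep s t : (forall N, coef_filter N (s - t)) -> s = t.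
Proof.
move=> st; apply: coef_inj => j; apply: Bsep => N.
by have := st (N + j)%N j; rewrite addnK coefB.
Qed.

(** Left multiplication by [x] gains one level in both parts: [sigma] keeps the exponent while the
    index goes up by one, and [delta] keeps the index while the exponent goes up by one. *)
Lemma coef_filter_XnM i N s : coef_filter N s -> coef_filter (i + N) (x ^+ i * s).
Proof.
move=> Ns; elim: i => [|i IHi]; first by rewrite mul1r.
rewrite exprS -mulrA => j; rewrite coef_xmul; apply: mpowD => //; last first.
  apply: (mpow_leq _ (delta_mpow (IHi j))).
  by rewrite addSn; case: (leqP j (i + N)) => [/subSn -> //|/eqP ->].
by case: j => [|j]; [apply: mpow0|apply: sigma_mpow; apply: IHi].
Qed.

(* [s] is approximated by polynomials, and for a monomial [emb b * x ^+ i] the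
   bound holds because [sigma] preserves the powers of the maximal ideal while
   [delta] raises the exponent by one. *)
Lemma coef_filterM M N s t :
  coef_filter M s -> coef_filter N t -> coef_filter (M + N) (s * t).
Proof.
move=> Ms Nt j; have [K /(_ K (leqnn _))[close _]] :=
  trunc_mul_close s t (M + N + j.+1).
have leMN : (M + N - j <= M + N + j.+1)%N.
  by rewrite (leq_trans (leq_subr _ _)) ?leq_addr.
have := close j (leq_addl _ _); move/(mpow_leq leMN)/(mpowN Bloc).
rewrite opprB => {close} close.
rewrite -[coef _ _](subrK (coef (trunc K s * t) j)); apply: mpowD => //.
rewrite mulr_suml coef_sum; apply: mpow_sum => // i _.
rewrite -mulrA coef_embM.
have := mpowM Bloc (Ms i) (coef_filter_XnM i Nt j); apply: mpow_leq.
(* The exponents add up: M + N - j <= (M - i) + (i + N - j), also with truncated subtraction. *)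
rewrite leq_subLR addnCA -maxnE (leq_trans _ (leq_add (leqnn _) (leq_maxr _ _))) //.
by rewrite addnA leq_add2r addnC -leq_subLR.
Qed.

Lemma coef_filterMl N s t : coef_filter N t -> coef_filter N (s * t).
Proof. by move=> Nt; have := @coef_filterM 0 N s t; rewrite add0n; apply. Qed.

Lemma coef_filterMr N s t : coef_filter N t -> coef_filter N (t * s).
Proof. by move=> Nt; have := @coef_filterM N 0 t s; rewrite addn0; apply. Qed.

Lemma coef_filter_leq M N s : (M <= N)%N -> coef_filter N s -> coef_filter M s.
Proof. by move=> leMN Ns j; apply: mpow_leq (Ns j); apply: leq_sub2r. Qed.

(** The limit is taken in each coefficient separately, by completeness of [B]. *)
Lemma coef_filter_complete (u : nat -> S) :
  (forall N, exists M, forall i j : nat,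
     (M <= i)%N -> (M <= j)%N -> coef_filter N (u i - u j)) ->
  exists l : S, forall N, exists M, forall i : nat,
     (M <= i)%N -> coef_filter N (u i - l).
Proof.
move=> u_cauchy; case: Bcl => _ [_ Bcomp].
have /choice[c cP] j : exists l : B, forall N, exists M, forall i : nat,
    (M <= i)%N -> mpow B N (coef (u i) j - l).
  apply: Bcomp => N; have [M uM] := u_cauchy (N + j)%N.
  exists M => i i' leMi leMi'; have := uM i i' leMi leMi' j.
  by rewrite addnK coefB.
have [l lc] := coef_surj c; exists l => N; have [M uM] := u_cauchy N.
exists M => i leMi j; have [M' cM] := cP j (N - j)%N.
(* The bound [M'] depends on [j], so the limit is reached through the auxiliary term of index
   [maxn M M']; the bound [M] on [i] stays uniform in [j]. *)
rewrite coefB lc -[coef (u i) j](subrK (coef (u (maxn M M')) j)) -addrA.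
apply: mpowD => //; last by apply: cM; rewrite leq_maxr.
by rewrite -coefB; apply: uM => //; rewrite leq_maxl.
Qed.

(** Geometric series: t^l lies in level l, so the partial sums are Cauchy, and their limit is a
    two-sided inverse. *)
Lemma unit_1B t : coef_filter 1 t -> 1 - t \is a GRing.unit.
Proof.
move=> t1; pose g i := \sum_(l < i) t ^+ l.
have tX l : coef_filter l (t ^+ l).
  elim: l => [|l IHl] //; rewrite exprS -add1n; exact: coef_filterM.
have gD i d : coef_filter i (g (i + d)%N - g i).
  rewrite /g big_split_ord /= [X in coef_filter _ X]addrC addKr.
  elim/big_rec: _ => [|l a _ Na]; first exact: coef_filter0.
  apply: coef_filterD => //; apply: coef_filter_leq (tX _); exact: leq_addr.
have [l lP] : exists l : S, forall N, exists M, forall i : nat,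
    (M <= i)%N -> coef_filter N (g i - l).
  apply: coef_filter_complete => N; exists N => i j leNi leNj.
  rewrite -(subnKC leNi) -(subnKC leNj) -[g (N + (i - N))%N](subrK (g N)) -addrA.
  by apply: coef_filterD => //; rewrite -opprB -sub0r; apply: coef_filterB;
    [apply: coef_filter0|].
have tg i : (1 - t) * g i = 1 - t ^+ i.
  by rewrite -opprB -[RHS]opprB subrX1 mulNr.
have gt i : g i * (1 - t) = 1 - t ^+ i.
  rewrite -tg; apply/esym/commr_sum => j _.
  by apply/commr_sym/commrB; [apply: commr1|apply/commr_sym/commrX].
apply/unitrP; exists l; split; apply: coef_filter_sep => N;
  have [M /(_ (maxn M N) (leq_maxl _ _)) lM] := lP N.
- rewrite -[l](subKr (g (maxn M N))) mulrBl gt [X in coef_filter _ X]addrAC.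
  rewrite [1 - _ - 1]addrAC subrr sub0r -opprD -sub0r.
  apply: coef_filterB; first exact: coef_filter0.
  apply: coef_filterD; first exact: coef_filter_leq (leq_maxr _ _) (tX _).
  exact: coef_filterMr.
- rewrite -[l](subKr (g (maxn M N))) mulrBr tg [X in coef_filter _ X]addrAC.
  rewrite [1 - _ - 1]addrAC subrr sub0r -opprD -sub0r.
  apply: coef_filterB; first exact: coef_filter0.
  apply: coef_filterD; first exact: coef_filter_leq (leq_maxr _ _) (tX _).
  exact: coef_filterMl.
Qed.

(** A series with invertible constant coefficient becomes 1 - t with t in level 1 after division by
    that coefficient, so it is a unit. Conversely, level 1 absorbs products and does not contain
    1. *)
Lemma nonunits_series : @nonunits S = coef_filter 1.
Proof.
have B1 := mpow1 Bloc; apply/seteqP; split=> s.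
  move=> ns [|j]; last by rewrite subSS.
  rewrite subn0 B1 /nonunits /=; apply: contraNN ns => u0.
  have -> : s = emb (coef s 0) * (emb (coef s 0)^-1 * s).
    by rewrite mulrA -rmorphM divrr // rmorph1 mul1r.
  rewrite unitrMl ?rmorph_unit //.
  rewrite -[_ * s](subKr 1); apply: unit_1B => -[|j]; last by rewrite subSS.
  rewrite coefB -(rmorph1 emb) coef_emb coef_embM mulVr // subrr; exact: mpow0.
move=> s1; apply/negP => us.
have := coef_filterMl s^-1 s1; rewrite mulVr // => /(_ 0%N).
by rewrite -(rmorph1 emb) coef_emb B1 /nonunits /= unitr1.
Qed.

Lemma local_ring_series : local_ring S.
Proof.
rewrite /local_ring nonunits_series; split.
- exact: coef_filter0.
- by move=> a b; apply: coef_filterD.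
- by move=> a b b1; split; [apply: coef_filterMl|apply: coef_filterMr].
Qed.

(** One inclusion is multiplicativity of the filtration. For the other, a series of level N is a sum
    of terms b x^i with i < N and b in m^(N-i), plus a left multiple of x^N. *)
Lemma mpow_series N : mpow S N = coef_filter N.
Proof.
have Sloc := local_ring_series.
apply/seteqP; split=> s.
  elim: N s => [//|N IHN] s [t [tI ->]]; rewrite big_seq.
  elim/big_rec: _ => [|u a /tI[u1 u2] Na]; first exact: coef_filter0.
  apply: coef_filterD => //; rewrite -add1n; apply: coef_filterM; last exact: IHN.
  by rewrite -nonunits_series.
have x1 i : mpow S i (x ^+ i).
  apply: mpowX => //; rewrite nonunits_series => -[|j]; last by rewrite subSS.
  by rewrite -(expr1 x) coefXn; apply: mpow0.
have emb_mpow i b : mpow B i b -> mpow S i (emb b).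
  elim: i b => [//|i IHi] b [t [tI ->]]; rewrite rmorph_sum; apply: mpow_sum => //.
  move=> u /tI[u1 u2]; rewrite rmorphM -add1n; apply: mpowM => //; last exact: IHi.
  rewrite mpow1 // nonunits_series => j; rewrite coef_emb.
  by case: j => [|j]; rewrite ?subSS // subn0 mpow1.
move=> Ns.
have [t tc] := coef_surj (fun j => coef s (N + j)%N).
have -> : s = trunc N s + t * x ^+ N.
  apply: coef_inj => j; rewrite coefD coef_trunc coef_mulXn.
  by case: leqP => [leNj|_]; rewrite ?addr0 // add0r tc subnKC.
apply: mpowD => //; last exact: mpowMl.
apply: mpow_sum => // i _; have := mpowM Sloc (emb_mpow _ _ (Ns i)) (x1 i).
by rewrite subnK // ltnW.
Qed.

Lemma complete_local_series : complete_local S.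
Proof.
split; first exact: local_ring_series.
split=> [s s0|u].
  by apply: coef_filter_sep => N; rewrite subr0 -mpow_series.
move=> u_cauchy; have [N|l lP] := @coef_filter_complete u.
  by have [M uM] := u_cauchy N; exists M => i j; rewrite -mpow_series; apply: uM.
exists l => N; have [M lM] := lP N; exists M => i.
rewrite mpow_series; exact: lM.
Qed.

End SkewPowerSeries.

(** * Digits *)

Definition mdegree n (alpha : mindex n) := (\sum_i alpha i)%N.

(** These are the monoid ideals of N^n. *)
Definition translation_closed n (U : set (mindex n)) :=
  forall alpha beta, U alpha -> U (alpha + beta).

(* [digit r alpha] plays the role of the coefficient of [x^alpha] in [r], read
   back in the residue field.  In mixed characteristic digits are not additive
   because of carries, but carries only go from [alpha] to [alpha + gamma]: the
   elements whose digits live in a translation-closed set form a subgroup, and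
   two elements have the same digits off that set iff they are congruent. *)
Record digit_system (k : fieldType) (n : nat) (R : unitRingType)
    (iota : k -> R) (x : n.-tuple R) (digit : R -> mindex n -> k) : Prop :=
  DigitSystem {
    digit_complete : complete_local R;
    iota1 : iota 1 = 1;
    iotaM : {morph iota : a b / a * b};
    iotaC : forall c r, GRing.comm (iota c) r;
    digit_surj : forall h, exists r, forall alpha, digit r alpha = h alpha;
    digitB : forall U r r', translation_closed U ->
      (forall alpha, ~ U alpha -> digit r alpha = digit r' alpha) <->
      (forall alpha, ~ U alpha -> digit (r - r') alpha = 0);
    digit_scale : forall U c r, translation_closed U ->
      (forall alpha, ~ U alpha -> digit r alpha = 0) ->
      forall alpha, ~ U alpha -> digit (iota c * r) alpha = 0;
    digit_mpow : forall N r,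
      mpow R N r <-> forall alpha, (mdegree alpha < N)%N -> digit r alpha = 0;
    digit_erase : forall r alpha beta,
      digit (r - iota (digit r alpha) * monomial x alpha) beta =
      if beta == alpha then 0 else digit r beta }.

(** Base of the tower in case (A): there are no variables, the maximal ideal is zero, and an element
    is its own single digit. *)
Lemma digit_system_field (k : fieldType) :
  digit_system id [tuple] (fun (a : k) (_ : mindex 0) => a).
Proof.
have nuk (a : k) : nonunits a <-> a = 0.
  rewrite /nonunits /= unitfE negbK; split=> [/eqP //|->]; exact: eqxx.
have kpow N (a : k) : mpow k N a <-> ((0 < N)%N -> a = 0).
  case: N => [|N]; first by split.
  split=> [[s [sI ->]] _|/(_ isT) ->]; last by exists [::]; rewrite big_nil.
  by rewrite big_seq big1 // => u /sI[/nuk -> _]; rewrite mul0r.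
have all0 (alpha beta : mindex 0) : alpha = beta by apply/ffunP => -[].
split=> //.
- split.
    split; first exact/nuk.
      by move=> a b /nuk -> /nuk ->; apply/nuk; rewrite addr0.
    by move=> a b /nuk ->; rewrite mulr0 mul0r; split; apply/nuk.
  split=> [b /(_ 1%N)/kpow -> //|u /(_ 1%N)[M uM]].
  exists (u M) => N; exists M => i leMi; apply/kpow => _.
  by move/kpow: (uM i M leMi (leqnn _)) => ->.
- by move=> c r; apply: mulrC.
- by move=> h; exists (h 0) => alpha; rewrite (all0 alpha 0).
- move=> U r r' _; split=> rr alpha /rr; first by move=> ->; rewrite subrr.
  by move/eqP; rewrite subr_eq0 => /eqP.
- by move=> U c r _ r0 alpha /r0 ->; rewrite mulr0.
- move=> N r; rewrite kpow; split=> [r0 alpha|r0 N_gt0].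
    by rewrite /mdegree big_ord0.
  by apply: (r0 0); rewrite /mdegree big_ord0.
- move=> r alpha beta; rewrite (all0 beta alpha) eqxx /monomial big_ord0 mulr1.
  exact: subrr.
Qed.

(** * Teichmueller digits in a complete discrete valuation ring *)

Section TeichmuellerDigits.
Variables (A : idomainType) (k : fieldType) (x1 : A).
Variables (res : {rmorphism A -> k}) (tau : k -> A).
Hypothesis Acl : complete_local A.
Hypothesis A_nontrivial : exists2 a : A, a != 0 & nonunits a.
Hypothesis x1_unif : uniformiser x1.
Hypothesis res_residue : residue_map res.
Hypothesis tau_section : multiplicative_section res tau.

Let Aloc : local_ring A := proj1 Acl.
Let tauM : {morph tau : a b / a * b} := proj1 tau_section.
Let tauK a : res (tau a) = a := proj2 tau_section a.

(** By multiplicativity [tau 0] is idempotent, hence 0 or 1 in the domain [A], and reduction to [k]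
    excludes 1. *)
Lemma section0 : tau 0 = 0.
Proof.
apply/eqP; have: tau 0 * (tau 0 - 1) == 0 by rewrite mulrBr mulr1 -tauM mulr0 subrr.
rewrite mulf_eq0 => /orP[//|]; rewrite subr_eq0 => /eqP t01.
by have := tauK 0; rewrite t01 rmorph1 => /eqP; rewrite oner_eq0.
Qed.

Lemma section1 : tau 1 = 1.
Proof.
apply/eqP; have: tau 1 * (tau 1 - 1) == 0 by rewrite mulrBr mulr1 -tauM mulr1 subrr.
rewrite mulf_eq0 subr_eq0 => /orP[|//] /eqP t10.
by have := tauK 1; rewrite t10 rmorph0 => /esym/eqP; rewrite oner_eq0.
Qed.

Let x1_neq0 : x1 != 0.
Proof.
case: A_nontrivial => a a0; rewrite -x1_unif => -[c ac].
by apply: contraNneq a0 => x0; rewrite ac x0 mulr0.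
Qed.

Let res_x1 a : res (a * x1) = 0.
Proof.
by apply/(proj2 res_residue); rewrite -x1_unif; exists a.
Qed.

(** Splitting off the lowest digit leaves a nonunit, that is, a multiple of the uniformiser.
    Iterating the chosen quotient map produces all further digits. *)
Lemma teichmueller_quotient : exists tl : A -> A,
  forall a, a = tau (res a) + tl a * x1.
Proof.
suff /choice[tl tlP] a : exists b, a = tau (res a) + b * x1 by exists tl.
have: nonunits (a - tau (res a)).
  by apply/(proj2 res_residue); rewrite rmorphB tauK subrr.
by rewrite -x1_unif => -[b ab]; exists b; rewrite -ab subrKC.
Qed.

Lemma mpow_uniformiser N : mpow A N = principal (x1 ^+ N).
Proof.
elim: N => [|N IHN]; apply/seteqP; split=> a //.
- by exists a; rewrite mulr1.
- rewrite mpowS => -[s [sI ->]]; rewrite big_seq; elim/big_rec: _ => [|u b /sI[]].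
    by exists 0; rewrite mul0r.
  rewrite IHN -x1_unif => -[c1 ->] [c2 ->] [c ->].
  by exists (c1 * c2 + c); rewrite mulrDl exprS mulrACA.
- case=> c ->; rewrite mpowS; exists [:: (x1, c * x1 ^+ N)].
  rewrite big_seq1 exprS mulrCA.
  split=> // u; rewrite inE => /eqP -> /=; rewrite IHN -x1_unif.
  by split; [exists 1; rewrite mul1r|exists c].
Qed.

Section Digits.
Variable tl : A -> A.
Hypothesis tlP : forall a, a = tau (res a) + tl a * x1.

Definition teichmueller_digit a i := res (iter i tl a).

Let res_cons c b : res (tau c + b * x1) = c.
Proof. by rewrite rmorphD tauK res_x1 addr0. Qed.

Let tl_cons c b : tl (tau c + b * x1) = b.
Proof.
apply: (mulIf x1_neq0); apply: (@addrI _ (tau c)).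
by rewrite -{1}(res_cons c b) -tlP.
Qed.

Let digit_cons c b i : teichmueller_digit (tau c + b * x1) i =
  if i is j.+1 then teichmueller_digit b j else c.
Proof.
by case: i => [|i]; rewrite /teichmueller_digit /= ?res_cons // -iterS iterSr tl_cons.
Qed.

Let digitS a i : teichmueller_digit a i.+1 = teichmueller_digit (tl a) i.
Proof. by rewrite /teichmueller_digit iterSr. Qed.

Lemma teichmueller_digit0 i : teichmueller_digit 0 i = 0.
Proof.
elim: i => [|i IHi]; first exact: rmorph0.
have e0 : tau 0 + 0 * x1 = 0 by rewrite mul0r addr0 section0.
by rewrite digitS -{1}e0 tl_cons.
Qed.

(** Digits are not additive, but equal lowest digits cancel in a - b, and dividing by [x1] then
    lowers N by one. *)
Lemma teichmueller_digitB N a b :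
  (forall i, (i < N)%N -> teichmueller_digit a i = teichmueller_digit b i) <->
  mpow A N (a - b).
Proof.
rewrite mpow_uniformiser; elim: N a b => [|N IHN] a b.
  by split=> // _; exists (a - b); rewrite mulr1.
split=> [ab|[c abc]].
  have [c tlc] : principal (x1 ^+ N) (tl a - tl b).
    by apply/IHN => i ltiN; rewrite -!digitS; apply: ab.
  exists c; rewrite [a]tlP [b]tlP.
  have /= -> : res a = res b by apply: (ab 0%N).
  by rewrite opprD addrACA subrr add0r -mulrBl tlc exprSr mulrA.
have res_ab : res a = res b.
  by apply/eqP; rewrite -subr_eq0 -rmorphB abc exprSr mulrA res_x1.
have tlc : tl a - tl b = c * x1 ^+ N.
  apply: (mulIf x1_neq0); rewrite -mulrA -exprSr -abc [in RHS](tlP a) [in RHS](tlP b).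
  by rewrite res_ab opprD addrACA subrr add0r mulrBl.
case=> [|i] ltiN; first exact: res_ab.
by rewrite !digitS; apply: (proj2 (IHN _ _)) => //; exists c.
Qed.

Lemma teichmueller_digit_erase a i j :
  teichmueller_digit (a - tau (teichmueller_digit a i) * x1 ^+ i) j =
  if j == i then 0 else teichmueller_digit a j.
Proof.
elim: i a j => [|i IHi] a j.
  rewrite mulr1 {1}[a]tlP addrAC subrr -section0 digit_cons.
  by case: j.
have -> : a - tau (teichmueller_digit a i.+1) * x1 ^+ i.+1 =
    tau (res a) + (tl a - tau (teichmueller_digit (tl a) i) * x1 ^+ i) * x1.
  by rewrite mulrBl addrA -tlP digitS -mulrA -exprSr.
by rewrite digit_cons; case: j => [|j] //; rewrite IHi digitS eqSS.
Qed.

Lemma teichmueller_digit_surj h :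
  exists a, forall i, teichmueller_digit a i = h i.
Proof.
pose u N := \sum_(i < N) tau (h i) * x1 ^+ i.
have uB N d : mpow A N (u (N + d)%N - u N).
  rewrite /u big_split_ord /= [X in mpow _ _ X]addrC addKr.
  apply: mpow_sum => // i _; rewrite mpow_uniformiser exprD mulrCA mulrC.
  by exists (tau (h (N + i)%N) * x1 ^+ i).
have ud N i : (i < N)%N -> teichmueller_digit (u N) i = h i.
  (* Removing the lowest digit shifts the sequence, so the induction has to run over all [h]. *)
  rewrite /u; elim: N h i {u uB} => [//|N IHN] h i ltiN.
  rewrite big_ord_recl mulr1 (eq_bigr (fun i : 'I_N => tau (h i.+1) * x1 ^+ i * x1)).
    rewrite -mulr_suml digit_cons; case: i ltiN => [//|i ltiN].
    by rewrite (IHN (fun i => h i.+1)).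
  by move=> j _; rewrite exprSr mulrA.
case: Acl => _ [_ /(_ u)[N|a ua]].
  exists N => i j leNi leNj.
  rewrite -(subnKC leNi) -(subnKC leNj) -[u (N + (i - N))%N](subrK (u N)) -addrA.
  by apply: mpowD => //; rewrite -opprB; apply: mpowN.
exists a => i; have [M uM] := ua i.+1.
have /(teichmueller_digitB _ _ _)/(_ i (ltnSn _)) <- := uM (maxn M i.+1) (leq_maxl _ _).
by apply: ud; rewrite leq_maxr.
Qed.

Lemma digit_system_dvr :
  digit_system tau [tuple x1] (fun a (alpha : mindex 1) =>
    teichmueller_digit a (alpha ord0)).
Proof.
have mindex1 (alpha : mindex 1) : alpha = [ffun=> alpha ord0].
  by apply/ffunP => i; rewrite ffunE ord1.
(* In one variable the complement of a translation-closed set is an initial segment. Agreement of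
   digits on it therefore amounts to congruences modulo powers of the maximal ideal, which are
   additive. *)
have below U (alpha : mindex 1) i : translation_closed U ->
    ~ U alpha -> (i < (alpha ord0).+1)%N -> ~ U [ffun=> i].
  move=> Ucl nUa; rewrite ltnS => lei; apply: contra_not nUa => Ui.
  have -> : alpha = [ffun=> i] + [ffun=> (alpha ord0 - i)%N].
    by apply/ffunP => j; rewrite !ffunE (ord1 j); apply/esym/subnKC.
  exact: Ucl.
have agree U a b : translation_closed U ->
    (forall alpha : mindex 1, ~ U alpha ->
      teichmueller_digit a (alpha ord0) = teichmueller_digit b (alpha ord0)) <->
    (forall alpha : mindex 1, ~ U alpha -> mpow A (alpha ord0).+1 (a - b)).
  move=> Ucl; split=> ab alpha nUa; last first.
    exact: (proj2 (teichmueller_digitB _ _ _) (ab _ nUa)).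
  apply/teichmueller_digitB => i lti.
  by have := ab _ (below _ _ _ Ucl nUa lti); rewrite ffunE.
have mpow_sub0 U a : translation_closed U ->
    (forall alpha : mindex 1, ~ U alpha -> teichmueller_digit a (alpha ord0) = 0) <->
    (forall alpha : mindex 1, ~ U alpha -> mpow A (alpha ord0).+1 a).
  move=> Ucl; rewrite -{2}[a]subr0 -agree //.
  by split=> a0 alpha /a0 ->; rewrite teichmueller_digit0.
split=> //.
- exact: section1.
- by move=> c a; apply: mulrC.
- move=> h; have [a ha] := teichmueller_digit_surj (fun i => h [ffun=> i]).
  by exists a => alpha; rewrite ha -mindex1.
- by move=> U a b Ucl; rewrite agree // -mpow_sub0.
- move=> U c a Ucl /mpow_sub0 a0; apply/mpow_sub0 => // alpha nUa.
  by apply: mpowMl => //; apply: a0.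
- move=> N a; rewrite -{1}[a]subr0 -teichmueller_digitB; split=> a0.
    by move=> alpha; rewrite /mdegree big_ord1 => /a0 ->; rewrite teichmueller_digit0.
  move=> i ltiN; have := a0 [ffun=> i]; rewrite /mdegree big_ord1 ffunE => -> //.
  by rewrite teichmueller_digit0.
- move=> a alpha beta; rewrite /monomial big_ord1 tnth0.
  rewrite teichmueller_digit_erase; congr (if _ then _ else _).
  apply/eqP/eqP => [ab|-> //]; by rewrite (mindex1 alpha) (mindex1 beta) ab.
Qed.

End Digits.
End TeichmuellerDigits.

(** * From n to n + 1 variables: splitting off the last exponent *)

Definition minit n (alpha : mindex n.+1) : mindex n :=
  [ffun i => alpha (widen_ord (leqnSn n) i)].

Definition mrcons n (alpha : mindex n) (j : nat) : mindex n.+1 :=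
  [ffun i => if unlift ord_max i is Some i' then alpha i' else j].

Lemma widen_ord_max n (i : 'I_n) : widen_ord (leqnSn n) i = lift ord_max i.
Proof. exact/val_inj/esym/lift_max. Qed.

Lemma mrconsK n (alpha : mindex n) j : minit (mrcons alpha j) = alpha.
Proof. by apply/ffunP => i; rewrite !ffunE widen_ord_max liftK. Qed.

Lemma mrcons_max n (alpha : mindex n) j : mrcons alpha j ord_max = j.
Proof. by rewrite ffunE unlift_none. Qed.

Lemma minitK n (alpha : mindex n.+1) : mrcons (minit alpha) (alpha ord_max) = alpha.
Proof.
apply/ffunP => i; rewrite ffunE; case: unliftP => [j ->|-> //].
by rewrite ffunE widen_ord_max.
Qed.

Lemma mindexS_eq n (alpha beta : mindex n.+1) :
  (alpha == beta) = (alpha ord_max == beta ord_max) && (minit alpha == minit beta).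
Proof.
apply/eqP/andP => [-> //|[/eqP ab /eqP ab']].
by rewrite -(minitK alpha) -(minitK beta) ab ab'.
Qed.

Lemma mrconsD n (alpha beta : mindex n) i j :
  mrcons (alpha + beta) (i + j) = mrcons alpha i + mrcons beta j.
Proof.
by apply/ffunP => l; rewrite !ffunE; case: unliftP => // l' _; rewrite !ffunE.
Qed.

Lemma mdegree_minit n (alpha : mindex n.+1) :
  mdegree alpha = (mdegree (minit alpha) + alpha ord_max)%N.
Proof.
rewrite /mdegree big_ord_recr; congr (_ + _)%N.
by apply: eq_bigr => i _; rewrite ffunE.
Qed.

Lemma monomial_rcons n (B S : nzRingType) (emb : {rmorphism B -> S})
    (xs : n.-tuple B) (y : S) (alpha : mindex n.+1) :
  monomial [tuple of rcons (map emb xs) y] alpha =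
  emb (monomial xs (minit alpha)) * y ^+ alpha ord_max.
Proof.
rewrite /monomial big_ord_recr rmorph_prod; congr (_ * _ ^+ _).
  apply: eq_bigr => i _; rewrite rmorphXn ffunE; congr (_ ^+ _).
  rewrite !(tnth_nth 0) /= nth_rcons size_map size_tuple ltn_ord.
  by rewrite (nth_map 0) ?size_tuple.
by rewrite (tnth_nth 0) /= nth_rcons size_map size_tuple ltnn eqxx.
Qed.

(** The digits of a series are the digits of its coefficients, the exponent of the new variable
    coming last. Differences and multiples by [iota c] are computed coefficientwise, so a
    translation-closed set is treated slice by slice, and [mpow_series] turns the filtration into a
    condition on the total degree. *)
Lemma digit_system_series (k : fieldType) n (B S : unitRingType)
    (iota : k -> B) (xs : n.-tuple B) digit
    (sigma : {rmorphism B -> B}) (delta : {additive B -> B})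
    (emb : {rmorphism B -> S}) (x : S) :
  digit_system iota xs digit -> local_skew_derivation sigma delta ->
  linear_over iota sigma delta -> is_skew_power_series sigma delta emb x ->
  exists digit', digit_system (fun c => emb (iota c))
    [tuple of rcons (map emb xs) x] digit'.
Proof.
move=> [Bcl i1 iM iC dsurj dB dscale dpow derase] sd_local lin.
case=> coef [[cinj csurj] clin cX skew cont].
exists (fun s (alpha : mindex n.+1) => digit (coef s (alpha ord_max)) (minit alpha)).
have Scl := complete_local_series Bcl sd_local cinj csurj clin cX skew cont.
pose slice U j : set (mindex n) := [set alpha | U (mrcons alpha j)].
have slice_closed U j : translation_closed U -> translation_closed (slice U j).
  by move=> Ucl a b Ua; rewrite /slice /= -[j]addn0 mrconsD; apply: Ucl.
have slice_minit (U : set (mindex n.+1)) alpha :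
    ~ U alpha -> ~ slice U (alpha ord_max) (minit alpha).
  by rewrite /slice /= minitK.
split=> //.
- by rewrite i1 rmorph1.
- by move=> a b; rewrite iM rmorphM.
- move=> c s; have [sc dc] := lin c.
  exact: (emb_central Bcl cinj clin cX skew cont).
- move=> h.
  have /choice[b bP] j : exists b, forall alpha, digit b alpha = h (mrcons alpha j).
    exact: (dsurj (fun alpha => h (mrcons alpha j))).
  by have [s sc] := csurj b; exists s => alpha; rewrite sc bP minitK.
- move=> U s t Ucl; split=> st alpha /slice_minit.
    rewrite (coefB clin); move: (minit alpha).
    apply/(dB _ _ _ (slice_closed _ _ Ucl)) => beta nU.
    by have := st _ nU; rewrite mrcons_max mrconsK.
  move: (minit alpha); apply/(dB _ _ _ (slice_closed _ _ Ucl)) => beta nU.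
  by have := st _ nU; rewrite mrcons_max mrconsK (coefB clin).
- move=> U c s Ucl s0 alpha /slice_minit.
  rewrite (coef_embM clin); apply: (dscale _ _ _ (slice_closed _ _ Ucl)) => beta nU.
  by have := s0 _ nU; rewrite mrcons_max mrconsK.
- move=> N s; rewrite (mpow_series Bcl sd_local cinj csurj clin cX skew cont).
  split=> [Ns alpha|s0 j].
    rewrite mdegree_minit => ltN; apply: (proj1 (dpow _ _) (Ns (alpha ord_max))).
    by rewrite ltn_subRL addnC.
  apply/dpow => alpha; rewrite ltn_subRL => ltN.
  have := s0 (mrcons alpha j); rewrite mdegree_minit mrcons_max mrconsK; apply.
  by rewrite addnC.
- move=> s alpha beta; rewrite (coefB clin) monomial_rcons mulrA -rmorphM.
  rewrite (coef_embM clin) cX mindexS_eq.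
  by have [->|_] := eqVneq (beta ord_max); rewrite ?mulr1 ?derase // mulr0 subr0.
Qed.

(** The number of variables grows along the induction, so the tuple is existentially quantified and
    tied to the list [xs] by its underlying sequence. *)
Lemma digit_system_tower (A R : unitRingType) (xs0 : seq A) (j : A -> R)
    (xs : seq R) (k : fieldType) (tau : k -> A) n0 (x0 : n0.-tuple A) digit0 :
  iterated_skew xs0 j xs -> tval x0 = xs0 -> digit_system tau x0 digit0 ->
  exists n (x : n.-tuple R) digit,
    tval x = xs /\ digit_system (fun c => j (tau c)) x digit.
Proof.
move=> + x0E ds0; elim=> [|{R j xs} B S j xs sigma delta emb x _ IH sd lin series].
  by exists n0, x0, digit0.
have [n [y [digit [yE ds]]]] := IH.
have lin' : linear_over (fun c => j (tau c)) sigma delta by move=> c; apply: lin.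
have [digit' ds'] := digit_system_series ds sd lin' series.
by exists n.+1, [tuple of rcons (map emb y) x], digit'; split; rewrite //= yE.
Qed.

Lemma digit_system_exists (p n : nat) (k : finFieldType) (R : unitRingType)
    (iota : k -> R) (x : n.-tuple R) :
  case_A p iota x \/ case_B p iota x -> exists digit, digit_system iota x digit.
Proof.
(* The tower yields a tuple whose length is only provably equal to [n]; this transports its digit
   system to [x]. *)
suff cast (xs : seq R) m (y : m.-tuple R) (io : k -> R) digit :
    tval x = xs -> tval y = xs -> io = iota -> digit_system io y digit ->
    exists digit, digit_system iota x digit.
  case=> [[_ tower]|[A [x1 [res [tau [j [[_ _ [_ Acl nt]]]]]]]]]; last first.
    case=> unif resP tauP tower iotaE.
    have [tl tlP] := teichmueller_quotient unif resP tauP.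
    have ds0 := digit_system_dvr Acl nt unif resP tauP tlP.
    have [m [y [d [yE ds]]]] := digit_system_tower tower erefl ds0.
    exact: (cast _ _ _ _ _ erefl yE (esym iotaE) ds).
  have ds0 := digit_system_field k.
  have [m [y [d [yE ds]]]] := digit_system_tower tower erefl ds0.
  exact: (cast _ _ _ _ _ erefl yE erefl ds).
move=> xE yE ioE ds.
have mn : n = m by have := size_tuple y; rewrite yE -xE size_tuple.
subst n; have <- : y = x by apply: val_inj; rewrite /= xE yE.
by rewrite -ioE; exists digit.
Qed.

(** * Expansions, supports and products in terms of digits *)

Section DigitSystem.
Variables (k : fieldType) (n : nat) (R : unitRingType) (iota : k -> R).
Variables (x : n.-tuple R) (digit : R -> mindex n -> k).
Hypothesis ds : digit_system iota x digit.

Let Rloc : local_ring R := proj1 (digit_complete ds).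

Lemma digit0 alpha : digit 0 alpha = 0.
Proof.
have cl0 : translation_closed (@set0 (mindex n)) by [].
by rewrite -(subrr 0); apply: (proj1 (digitB ds 0 0 cl0)).
Qed.

(** Taking the empty set in [digitB], all digits of the difference vanish, so the difference lies in
    every power of the maximal ideal. *)
Lemma digit_inj r r' : (forall alpha, digit r alpha = digit r' alpha) -> r = r'.
Proof.
have cl0 : translation_closed (@set0 (mindex n)) by [].
move=> rr'; apply/eqP; rewrite -subr_eq0; apply/eqP.
have [_ [sep _]] := digit_complete ds; apply: sep => N; apply/(digit_mpow ds) => alpha _.
exact: (proj1 (digitB ds r r' cl0)).
Qed.

Lemma digit_eq0 r : (forall alpha, digit r alpha = 0) -> r = 0.
Proof. by move=> r0; apply: digit_inj => alpha; rewrite digit0. Qed.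

Lemma monomial0 : monomial x 0 = 1.
Proof. by rewrite /monomial big1 // => i _; rewrite ffunE expr0. Qed.

(** Erasing the digit of 0 at exponent 0 leaves an element without nonzero digits. *)
Lemma iota0 : iota 0 = 0.
Proof.
have: 0 - iota (digit 0 0) * monomial x 0 = 0.
  by apply: digit_eq0 => alpha; rewrite (digit_erase ds) digit0 if_same.
by rewrite digit0 monomial0 mulr1 sub0r => /eqP; rewrite oppr_eq0 => /eqP.
Qed.

Lemma iota_eq0 c : (iota c == 0) = (c == 0).
Proof.
apply/eqP/eqP => [ic|->]; last exact: iota0.
apply/eqP; apply: contraT => c0.
have := iota1 ds; rewrite -(divff c0) (iotaM ds) ic mul0r => /esym/eqP.
by rewrite oner_eq0.
Qed.

Lemma digit_erase_seq (s : seq (mindex n)) r beta : uniq s ->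
  digit (r - \sum_(alpha <- s) iota (digit r alpha) * monomial x alpha) beta =
  if beta \in s then 0 else digit r beta.
Proof.
elim: s beta => [|alpha s IHs] beta /=; first by rewrite big_nil subr0.
case/andP=> alphas us; rewrite big_cons.
set t := \sum_(_ <- _) _ in IHs *; set d := digit r alpha.
have -> : r - (iota d * monomial x alpha + t) =
    (r - t) - iota (digit (r - t) alpha) * monomial x alpha.
  by rewrite IHs // (negPf alphas) opprD addrCA [in RHS]addrC.
by rewrite (digit_erase ds) inE IHs //; case: eqP.
Qed.

Lemma bounded_degree_finite N :
  exists s : seq (mindex n), forall alpha, (mdegree alpha < N)%N -> alpha \in s.
Proof.
case: N => [|N]; first by exists [::].
exists [seq [ffun i => g i : nat] | g : {ffun 'I_n -> 'I_N.+1}] => alpha dalpha.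
apply/mapP; exists [ffun i => inord (alpha i)]; first by rewrite mem_enum.
apply/ffunP => i; rewrite !ffunE inordK //; apply: leq_trans dalpha.
by rewrite ltnS /mdegree (bigD1 i) //= leq_addr.
Qed.

Lemma partial_sum_close r N : exists s0 : seq (mindex n), forall s,
  uniq s -> {subset s0 <= s} ->
  mpow R N (r - \sum_(alpha <- s) iota (digit r alpha) * monomial x alpha).
Proof.
have [s0 s0P] := bounded_degree_finite N; exists s0 => s us s0s.
apply/(digit_mpow ds) => alpha /s0P/s0s alphas.
by rewrite digit_erase_seq // alphas.
Qed.

Lemma expansion_digit r : expansion iota x r (fun alpha => iota (digit r alpha)).
Proof. by split=> [alpha|N]; [exists (digit r alpha)|apply: partial_sum_close]. Qed.

(** The coefficients of any expansion are the digits of some [r']; then [r] and [r'] are limits of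
    the same partial sums, hence equal. *)
Lemma expansion_unique r c alpha :
  expansion iota x r c -> c alpha = iota (digit r alpha).
Proof.
case=> /choice[h ch] rc; have [r' r'h] := digit_surj ds h.
suff -> : r = r' by rewrite ch r'h.
apply/eqP; rewrite -subr_eq0; apply/eqP.
have [_ [sep _]] := digit_complete ds; apply: sep => N.
have [s0 s0P] := rc N; have [s1 s1P] := partial_sum_close r' N.
pose s := undup (s0 ++ s1).
have same : \sum_(beta <- s) iota (digit r' beta) * monomial x beta =
    \sum_(beta <- s) c beta * monomial x beta.
  by apply: eq_bigr => beta _; rewrite r'h ch.
have := mpowB Rloc (s0P s (undup_uniq _) _) (s1P s (undup_uniq _) _).
rewrite same opprB addrA subrK; apply=> beta; rewrite mem_undup mem_cat => ->//.
exact: orbT.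
Qed.

Lemma suppE r : supp iota x r = [set alpha | digit r alpha != 0].
Proof.
apply/seteqP; split=> alpha /=.
  by case=> c /(expansion_unique alpha) ->; rewrite iota_eq0.
move=> r0; exists (fun alpha => iota (digit r alpha)); rewrite ?iota_eq0 //.
exact: expansion_digit.
Qed.

(** For translation-closed [U] these elements form a subgroup stable under [iota], in spite of
    carries. *)
Definition supported (U : set (mindex n)) r :=
  forall alpha, ~ U alpha -> digit r alpha = 0.

Lemma supported_sub U V r : U `<=` V -> supported U r -> supported V r.
Proof. by move=> UV Ur alpha nV; apply: Ur => /UV. Qed.

Section Closed.
Variable U : set (mindex n).
Hypothesis Ucl : translation_closed U.

Lemma supported0 : supported U 0.
Proof. by move=> alpha _; apply: digit0. Qed.

Lemma supportedB r r' : supported U r -> supported U r' -> supported U (r - r').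
Proof. by move=> Ur Ur'; apply/(digitB ds) => // alpha nU; rewrite Ur // Ur'. Qed.

Lemma supportedD r r' : supported U r -> supported U r' -> supported U (r + r').
Proof.
move=> Ur Ur'; rewrite -[r']opprK; apply: supportedB => //.
by rewrite -sub0r; apply: supportedB => //; apply: supported0.
Qed.

Lemma supported_sum (I : Type) (s : seq I) (P : pred I) (G : I -> R) :
  (forall i, P i -> supported U (G i)) -> supported U (\sum_(i <- s | P i) G i).
Proof.
move=> UG; elim/big_rec: _ => [|i r /UG]; [exact: supported0|exact: supportedD].
Qed.

Lemma supportedZ c r : supported U r -> supported U (iota c * r).
Proof. exact: (digit_scale ds). Qed.

Lemma supported_closed r :
  (forall N, exists2 r', supported U r' & mpow R N (r - r')) -> supported U r.
Proof.
move=> rlim alpha nU; have [r' Ur'] := rlim (mdegree alpha).+1.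
move/(digit_mpow ds) => rr'; rewrite -(Ur' alpha nU).
(* Exponents of degree larger than that of [alpha] form a translation-closed set, so the congruence
   between [r] and [r'] gives them equal digits at [alpha]. *)
pose high := [set beta : mindex n | (mdegree alpha < mdegree beta)%N].
have high_closed : translation_closed high.
  move=> beta gamma; rewrite /high /= => /leq_trans; apply.
  by apply: leq_sum => i _; rewrite ffunE; apply: leq_addr.
apply: (proj2 (digitB ds r r' high_closed)); last by rewrite /high /= ltnn.
by move=> beta; rewrite /high /= => /negP nh; apply: rr'; rewrite ltnS leqNgt.
Qed.

End Closed.

(** Reduces products of series to products of monomials: both factors are replaced by finite partial
    sums congruent to them to arbitrarily high order. *)
Lemma supportedM (U V W : set (mindex n)) r r' : translation_closed W ->
  (forall alpha beta, U alpha -> V beta ->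
    supported W (monomial x alpha * monomial x beta)) ->
  supported U r -> supported V r' -> supported W (r * r').
Proof.
move=> Wcl UVW Ur Vr'; apply: supported_closed => // N.
have [s /(_ (undup s) (undup_uniq _)) sP] := partial_sum_close r N.
have [t /(_ (undup t) (undup_uniq _)) tP] := partial_sum_close r' N.
move: sP tP; set S := (\sum_(_ <- _) _); set T := (\sum_(_ <- _) _) => sP tP.
exists (S * T).
  rewrite mulr_suml; apply: supported_sum => // alpha _.
  rewrite mulr_sumr; apply: supported_sum => // beta _.
  have [Ua|nUa] := pselect (U alpha); last first.
    by rewrite Ur // iota0 !mul0r; apply: supported0.
  have [Vb|nVb] := pselect (V beta); last first.
    by rewrite Vr' // iota0 mul0r mulr0; apply: supported0.
  rewrite -mulrA [monomial x alpha * _]mulrA -[monomial x alpha * _](iotaC ds).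
  by rewrite -mulrA; do 2 apply: supportedZ => //; apply: UVW.
have -> : r * r' - S * T = (r - S) * r' + S * (r' - T).
  by rewrite mulrBl mulrBr addrA subrK.
apply: mpowD => //; [apply: mpowMr => //; apply: sP|apply: mpowMl => //; apply: tP].
  by move=> a; rewrite mem_undup.
by move=> a; rewrite mem_undup.
Qed.

End DigitSystem.

(** * Additive orders *)

(** Each step jumps to an index at which [u] is minimal among all later indices. *)
Lemma nondecreasing_subsequence (u : nat -> nat) : exists phi : nat -> nat,
  {homo phi : i j / (i < j)%N} /\ {homo u \o phi : i j / (i <= j)%N}.
Proof.
have /choice[m mP] i : exists j, (i <= j)%N /\ forall l, (i <= l)%N -> (u j <= u l)%N.
  have : exists v, `[<exists2 j, (i <= j)%N & u j = v>].
    by exists (u i); apply/asboolP; exists i.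
  case/ex_minnP => _ /asboolP[j leij <-] min; exists j; split=> // l leil.
  by apply: min; apply/asboolP; exists l.
pose phi := fix phi i := if i is j.+1 then m (phi j).+1 else m 0%N.
have phi_lt : {homo phi : i j / (i < j)%N}.
  apply: homo_ltn => [j i l|i]; first exact: ltn_trans.
  by have [] := mP (phi i).+1.
have phi_le : {homo phi : i j / (i <= j)%N}.
  by apply: homo_leq => [//|j i l|i]; [exact: leq_trans|rewrite ltnW // phi_lt].
exists phi; split=> // i j /phi_le; case: i => [|i] lephi /=.
  by have [_] := mP 0%N; apply.
have [le1 min] := mP (phi i).+1; apply: min; exact: leq_trans lephi.
Qed.

(** The coordinates are made nondecreasing one after the other by passing to subsequences; the first
    two terms of the last subsequence then serve. *)
Lemma dickson n (u : nat -> mindex n) :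
  exists i j, (i < j)%N /\ forall l, (u i l <= u j l)%N.
Proof.
suff /(_ n)[phi [phi_lt phi_le]] m : exists phi : nat -> nat,
    {homo phi : i j / (i < j)%N} /\
    forall l : 'I_n, (l < m)%N -> {homo (fun i => u (phi i) l) : i j / (i <= j)%N}.
  by exists (phi 0%N), (phi 1%N); split=> [|l]; [apply: phi_lt|apply: phi_le].
elim: m => [|m [phi [phi_lt phi_le]]]; first by exists id; split=> [i j|l].
have [ltmn|lenm] := ltnP m n; last first.
  by exists phi; split=> // l _; apply: phi_le; apply: leq_trans (ltn_ord l) lenm.
have [psi [psi_lt psi_le]] :=
  nondecreasing_subsequence (fun i => u (phi i) (Ordinal ltmn)).
exists (phi \o psi); split=> [i j /psi_lt/phi_lt //|l].
rewrite ltnS leq_eqVlt => /orP[/eqP lm|ltlm] i j leij.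
  by have -> : l = Ordinal ltmn; [apply: val_inj|apply: psi_le].
apply: (phi_le l ltlm); move: leij; rewrite leq_eqVlt => /orP[/eqP -> //|/psi_lt].
exact: ltnW.
Qed.

Section AdditiveOrder.
Variables (n : nat) (le : rel (mindex n)).
Hypothesis le_order : additive_total_order le.

Definition mlt (a b : mindex n) := (a != b) && le a b.

Lemma le_refl : reflexive le.
Proof. by case: le_order => -[]. Qed.

Lemma le_anti : antisymmetric le.
Proof. by case: le_order => -[]. Qed.

Lemma le_trans : transitive le.
Proof. by case: le_order => -[]. Qed.

Lemma le_total : total le.
Proof. by case: le_order => -[]. Qed.

Lemma mltNge a b : mlt a b = ~~ le b a.
Proof.
rewrite /mlt; have [->|ab] /= := eqVneq; first by rewrite le_refl.
apply/idP/idP => [leab|]; last by have := le_total a b; case: (le a b) => //= ->.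
by apply: contra ab => leba; rewrite (@le_anti a b) // leab.
Qed.

Lemma le_eqVmlt a b : le a b = (a == b) || mlt a b.
Proof. by rewrite /mlt; case: eqVneq => //= ->; apply: le_refl. Qed.

Lemma mltxx a : mlt a a = false.
Proof. by rewrite /mlt eqxx. Qed.

Lemma mltW a b : mlt a b -> le a b.
Proof. by case/andP. Qed.

Lemma mlt_le_trans b a c : mlt a b -> le b c -> mlt a c.
Proof.
rewrite !mltNge => nba lebc; apply: contra nba => leca; exact: le_trans leca.
Qed.

Lemma le_mlt_trans b a c : le a b -> mlt b c -> mlt a c.
Proof.
rewrite !mltNge => leab; apply: contra => leca; exact: le_trans leab.
Qed.

Lemma mltD2r c a b : mlt (a + c) (b + c) = mlt a b.
Proof.
case: le_order => _ _ add; apply/idP/idP => [|/add]; last exact.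
apply: contraLR; rewrite !mltNge !negbK !le_eqVmlt.
case/orP=> [/eqP ->|/add lt]; first by rewrite eqxx.
by rewrite [mlt _ _]lt orbT.
Qed.

Lemma leD2r c a b : le (a + c) (b + c) = le a b.
Proof. by apply: negb_inj; rewrite -!mltNge mltD2r. Qed.

Lemma leD2l c a b : le (c + a) (c + b) = le a b.
Proof. by rewrite ![c + _]addrC leD2r. Qed.

Lemma le_addr a b : le a (a + b).
Proof.
case: le_order => _ pos _; rewrite -{1}[a]addr0 leD2l.
by have [->|/pos/andP[]//] := eqVneq b 0; apply: le_refl.
Qed.

(** An inaccessible element starts an infinite strictly descending sequence. Dickson's lemma finds a
    later term of the form [u i] plus an exponent, which cannot be smaller than [u i]. *)
Lemma mlt_wf : well_founded mlt.
Proof.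
move=> a; apply: contrapT => nAa.
have /choice[g gP] b : exists c, ~ Acc mlt b -> mlt c b /\ ~ Acc mlt c.
  have [?|nAb] := pselect (Acc mlt b); first by exists b.
  apply: contrapT => nc; apply: nAb; constructor => c ltcb.
  by apply: contrapT => nAc; apply: nc; exists c.
pose u i := iter i g a.
have nAu i : ~ Acc mlt (u i) by elim: i => [//|i /gP[]].
have u_lt i j : (i < j)%N -> mlt (u j) (u i).
  elim: j => [//|j IHj]; rewrite ltnS leq_eqVlt => /orP[/eqP ->|/IHj].
    by case: (gP _ (nAu j)).
  by case: (gP _ (nAu j)) => + _ => /mltW; apply: le_mlt_trans.
have [i [j [ltij leu]]] := dickson u.
have := u_lt _ _ ltij; rewrite mltNge.
have -> : u j = u i + [ffun l => (u j l - u i l)%N].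
  by apply/ffunP => l; rewrite !ffunE; apply/esym/subnKC.
by rewrite le_addr.
Qed.

Lemma mlt_minimal (P : mindex n -> Prop) a : P a ->
  exists b, P b /\ forall c, mlt c b -> ~ P c.
Proof.
elim/(well_founded_ind mlt_wf): a => a IHa Pa.
have [[b [ltba Pb]]|min] := pselect (exists b, mlt b a /\ P b).
  exact: IHa ltba Pb.
by exists a; split=> // c ltca Pc; apply: min; exists c.
Qed.

Lemma translation_closed_le a : translation_closed [set b | le a b].
Proof. by move=> b c /= /le_trans; apply; apply: le_addr. Qed.

Lemma translation_closed_mlt a : translation_closed [set b | mlt a b].
Proof. by move=> b c /= /mlt_le_trans; apply; apply: le_addr. Qed.

End AdditiveOrder.

Arguments translation_closed_le {n le} le_order a.
Arguments translation_closed_mlt {n le} le_order a.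

(* Given the values below [alpha], the value of [Phi h] at [alpha] is an injective
   function of [h alpha], hence a bijective one because [K] is finite. *)
Lemma triangular_surjective (T : Type) (lt : rel T) (K : finType) (c0 : K)
    (Phi : (T -> K) -> T -> K) :
  well_founded lt ->
  (forall alpha h h', (forall beta, lt beta alpha -> h beta = h' beta) ->
     Phi h alpha = Phi h' alpha <-> h alpha = h' alpha) ->
  forall g, exists h, forall alpha, Phi h alpha = g alpha.
Proof.
move=> lt_wf tri g.
(* Keeps the values known below [alpha] and puts [c] everywhere else; for [Phi] at [alpha], only the
   value at [alpha] itself then counts. *)
pose trial alpha (below : forall beta, lt beta alpha -> K) c beta :=
  if pselect (lt beta alpha) is left ltba then below beta ltba else c.
(* The default [c0] is never reached: [nextP] shows that a suitable [c] exists. *)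
pose next alpha below :=
  odflt c0 [pick c | Phi (trial alpha below c) alpha == g alpha].
have lt_irr alpha : ~ lt alpha alpha.
  by elim/(well_founded_ind lt_wf): alpha => alpha IH la; apply: IH (la) la.
have nextP alpha below :
    Phi (trial alpha below (next alpha below)) alpha = g alpha.
  have [f _ fK] : bijective (fun c => Phi (trial alpha below c) alpha).
    apply: injF_bij => c c' eqc.
    suff: trial alpha below c alpha = trial alpha below c' alpha.
      by rewrite /trial; case: pselect => [la|//]; case: (lt_irr _ la).
    by apply/tri => // beta ltb; rewrite /trial; case: pselect.
  rewrite /next; case: pickP => [c /eqP //|/(_ (f (g alpha)))].
  by rewrite fK eqxx.
pose h := Fix lt_wf (fun=> K) next.
have hE alpha : h alpha = next alpha (fun beta _ => h beta).
  apply: (Fix_eq lt_wf (fun=> K) next) => beta f f' ff'; congr next.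
  by apply: functional_extensionality_dep => gamma; apply: funext.
exists h => alpha; rewrite -(nextP alpha (fun beta _ => h beta)) -hE.
by apply/tri => [beta ltb|]; rewrite /trial; case: pselect.
Qed.

(** * Division *)

Section LeadingMonomials.
Variables (k : fieldType) (n : nat) (R : unitRingType) (iota : k -> R).
Variables (x : n.-tuple R) (digit : R -> mindex n -> k) (le : rel (mindex n)).
Hypothesis ds : digit_system iota x digit.
Hypothesis le_mono : monomial_order iota x le.

Let le_order : additive_total_order le := proj1 le_mono.

(** Brings leading monomials into a form to which the results on supports in translation-closed sets
    apply, the exponents at or above [a] being such a set. *)
Lemma LM_SomeP r a : LM iota x le r = Some a <->
  digit r a != 0 /\ supported digit [set b | le a b] r.
Proof.
have isminE b : is_min le (supp iota x r) b <->
    digit r b != 0 /\ supported digit [set b' | le b b'] r.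
  rewrite /is_min (suppE ds); split=> -[/= rb min]; split=> // c.
    move=> /= nle; apply/eqP; by apply: contraT => /min /nle.
  by move=> rc; apply: contrapT => /min /eqP; apply/negP.
rewrite /LM -isminE; split=> [|mina].
  by case: xgetP => [y -> [b mb <-] [<-] //|//].
apply: xget_unique => [|y [b minb <-]]; first by exists a.
congr Some; apply: (le_anti le_order); case: mina => ra mina; case: minb => rb minb.
by rewrite minb // mina.
Qed.

Lemma LM_None r : LM iota x le r = None -> r = 0.
Proof.
move=> LMr; apply: (digit_eq0 ds) => alpha; apply/eqP; apply: contraT => ra.
have [b [rb minb]] := mlt_minimal le_order (P := fun b => digit r b != 0) ra.
suff : LM iota x le r = Some b by rewrite LMr.
apply/LM_SomeP; split=> // c /= nle; apply/eqP; apply: contraT => rc.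
by case: (minb c); rewrite // mltNge //; apply/negP.
Qed.

Lemma LM0 : LM iota x le 0 = None.
Proof.
case LMr: (LM iota x le 0) => [a|//].
by move/LM_SomeP: LMr => [+ _]; rewrite (digit0 ds) eqxx.
Qed.

Lemma supported_monomialM a b :
  supported digit [set c | le (a + b) c] (monomial x a * monomial x b).
Proof. by case: le_mono => _ /(_ a b)/LM_SomeP[]. Qed.

Lemma supported_monomial a : supported digit [set c | le a c] (monomial x a).
Proof. by have := @supported_monomialM a 0; rewrite addr0 (monomial0 x) mulr1. Qed.

Lemma supported_mlt a r : supported digit [set b | le a b] r -> digit r a = 0 ->
  supported digit [set b | mlt le a b] r.
Proof.
move=> ra r0 b /= nab; have [->//|neab] := eqVneq b a.
apply: ra => /= leab; apply: nab; rewrite (le_eqVmlt le_order) in leab.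
by case/orP: leab neab => [/eqP ->|//]; rewrite eqxx.
Qed.

(** Digits of sums are not sums of digits, so the argument is by supports. If the digit vanished, r
    r' would be supported strictly above a + b; removing the contributions of the non-leading parts
    would leave the product of the leading terms supported there too, against the monomial order. *)
Lemma digit_leadM a b r r' :
  supported digit [set c | le a c] r -> supported digit [set c | le b c] r' ->
  digit r a != 0 -> digit r' b != 0 -> digit (r * r') (a + b) != 0.
Proof.
move=> ra r'b nra nr'b.
have erase_lead c s : supported digit [set d | le c d] s ->
    supported digit [set d | mlt le c d] (s - iota (digit s c) * monomial x c).
  move=> sc d /= ncd; rewrite (digit_erase ds); case: eqP => // /eqP ne; apply: sc.
  move=> /= lecd; apply: ncd; move: lecd.
  rewrite (le_eqVmlt le_order) => /orP[/eqP cd|//].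
  by rewrite cd eqxx in ne.
have leadM (U V : set (mindex n)) s s' :
    (forall c d, U c -> V d -> mlt le (a + b) (c + d)) ->
    supported digit U s -> supported digit V s' ->
    supported digit [set c | mlt le (a + b) c] (s * s').
  move=> UV; apply: (supportedM ds (translation_closed_mlt le_order _)) => c d Uc Vd.
  apply: supported_sub (@supported_monomialM c d) => e /=.
  exact: (mlt_le_trans le_order (UV _ _ Uc Vd)).
have gtcl := translation_closed_mlt le_order (a + b).
apply/negP => /eqP rr'0.
have rr'gt : supported digit [set c | mlt le (a + b) c] (r * r').
  apply: supported_mlt rr'0; apply: (supportedM ds _ _ ra r'b).
    exact: translation_closed_le.
  move=> c d /= leac lebd; apply: supported_sub (@supported_monomialM c d) => e /=.
  apply: (le_trans le_order); apply: (le_trans le_order (y := c + b)).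
    by rewrite leD2r.
  by rewrite leD2l.
set c := digit r a in nra *; set d := digit r' b in nr'b *.
have : supported digit [set e | mlt le (a + b) e]
    (iota (c * d) * (monomial x a * monomial x b)).
  (* Each of the two subtracted products contains a factor whose leading term has been erased, so
     both are supported strictly above a + b. *)
  have -> : iota (c * d) * (monomial x a * monomial x b) = r * r' -
      ((r - iota c * monomial x a) * r' +
       iota c * (monomial x a * (r' - iota d * monomial x b))).
    rewrite !mulrBr mulrBl [iota c * (_ * r')]mulrA addrA subrK opprB addrC subrK.
    by rewrite (iotaM ds) -mulrA; congr (_ * _); rewrite !mulrA (iotaC ds).
  apply: (supportedB ds gtcl) => //; apply: (supportedD ds gtcl).
    apply: leadM (erase_lead _ _ ra) r'b => e e' /= ltae lebe'.
    apply: (mlt_le_trans le_order (b := e + b)); first by rewrite mltD2r.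
    by rewrite leD2l.
  apply: (supportedZ ds gtcl); apply: leadM (@supported_monomial a) (erase_lead _ _ r'b).
  move=> e e' /= leae ltbe'; apply: (le_mlt_trans le_order (b := e + b)).
    by rewrite leD2r.
  by rewrite ![e + _]addrC mltD2r.
move/(supportedZ ds gtcl (c * d)^-1).
rewrite mulrA -(iotaM ds) mulVf ?mulf_neq0 // (iota1 ds) mul1r => /(_ (a + b)) /=.
rewrite mltxx => /(_ (fun h => False_ind _ (notF h)))/eqP.
by case: le_mono => _ /(_ a b)/LM_SomeP[/negPf ->].
Qed.

End LeadingMonomials.

(** * Existence, uniqueness and leading monomials of the division *)

Section Division.
Variables (k : finFieldType) (n s : nat) (R : unitRingType) (iota : k -> R).
Variables (x : n.-tuple R) (digit : R -> mindex n -> k) (le : rel (mindex n)).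
Variable F : s.-tuple R.
Hypothesis ds : digit_system iota x digit.
Hypothesis le_mono : monomial_order iota x le.
Hypothesis F_neq0 : forall i : 'I_s, tnth F i != 0.

Let le_order : additive_total_order le := proj1 le_mono.

Notation DeltaF i := (Delta_F iota x le F i).

Lemma Delta_F_disjoint (i j : 'I_s) alpha : DeltaF i alpha -> DeltaF j alpha -> i = j.
Proof.
have disj (i' j' : 'I_s) : (i' < j')%N -> DeltaF i' alpha -> DeltaF j' alpha -> False.
  rewrite /Delta_F => ltij Di; rewrite DeltaE => -[_]; apply.
  by exists i'.
move=> Di Dj; apply: val_inj; case: (ltngtP i j) => // lt.
  by case: (disj _ _ lt).
by case: (disj _ _ lt).
Qed.

Lemma Delta_barE alpha :
  Delta_bar iota x le F alpha <-> forall i : 'I_s, ~ DeltaF i alpha.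
Proof.
split=> [nD i Di|nD [i /= ltis Di]]; first by apply: nD; exists (i : nat) => /=.
exact: (nD (Ordinal ltis)).
Qed.

Lemma LM_divisors : exists e : 'I_s -> mindex n, forall i,
  LM iota x le (tnth F i) = Some (e i).
Proof.
suff /choice[e eP] i : exists a, LM iota x le (tnth F i) = Some a by exists e.
case LMi: (LM _ _ _ _) => [a|]; first by exists a.
by have := F_neq0 i; rewrite (LM_None ds le_mono LMi) eqxx.
Qed.

Variable e : 'I_s -> mindex n.
Hypothesis LM_F : forall i, LM iota x le (tnth F i) = Some (e i).

Lemma Delta_F_shift (i : 'I_s) alpha :
  DeltaF i alpha -> exists gamma, alpha = gamma + e i.
Proof.
case=> -[b [c [_ + ->]]] _; rewrite -tnth_nth LM_F => -[->].
by exists b.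
Qed.

Definition admissible (q : s.-tuple R) (r : R) :=
  (forall i gamma, digit (tnth q i) gamma != 0 -> DeltaF i (gamma + e i)) /\
  forall alpha, digit r alpha != 0 -> Delta_bar iota x le F alpha.

Definition combination (q : s.-tuple R) (r : R) :=
  \sum_(i < s) tnth q i * tnth F i + r.

Lemma is_divisionE f q r :
  is_division iota x le F f q r <-> f = combination q r /\ admissible q r.
Proof.
rewrite /is_division /admissible (suppE ds).
split=> [[-> qD rD]|[-> [qD rD]]]; split=> //.
  split=> // i gamma qi; apply: qD; rewrite LM_F.
  by exists gamma, (e i); rewrite (suppE ds).
move=> i _ [b [c [qb +]]] ->; rewrite LM_F => -[<-]; apply: qD.
by move: qb; rewrite (suppE ds).
Qed.

(** A digit of q_i is filed under the exponent where it meets the leading monomial of f_i. All i are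
    compared, also those whose block does not contain [alpha]. *)
Definition agree_at (q : s.-tuple R) r (q' : s.-tuple R) r' alpha :=
  (forall i gamma, gamma + e i = alpha ->
     digit (tnth q i) gamma = digit (tnth q' i) gamma) /\
  digit r alpha = digit r' alpha.

(** The last two conditions place [U] between the strict and the weak upper set of [alpha], so that
    one proof serves for both. *)
Lemma supported_term (U : set (mindex n)) alpha q i : translation_closed U ->
  (forall gamma, ~ U (gamma + e i) -> digit q gamma = 0) ->
  (forall gamma, U gamma -> le alpha gamma) -> [set b | mlt le alpha b] `<=` U ->
  supported digit U (q * tnth F i).
Proof.
move=> Ucl qU Ule leU.
have [_ Fi] := proj1 (LM_SomeP ds le_mono _ _) (LM_F i).
apply: (supportedM ds Ucl (U := [set gamma | U (gamma + e i)]) _ _ Fi).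
  move=> a b /= Ua leb.
  apply: supported_sub (supported_monomialM ds le_mono (a := a) (b := b)) => c /=.
  rewrite (le_eqVmlt le_order) => /orP[/eqP <-|ltc].
    have [<-//|neb] := eqVneq (e i) b; apply: leU => /=.
    apply: (le_mlt_trans le_order (Ule _ Ua)).
    by rewrite ![a + _]addrC mltD2r // /mlt neb.
  apply: leU => /=; apply: (le_mlt_trans le_order (Ule _ Ua)).
  by apply: (le_mlt_trans le_order (b := a + b)); rewrite ?leD2l.
by move=> gamma /= /qU.
Qed.

(* If two admissible data agree below [alpha], their combinations agree below
   [alpha], and only the block of [Delta]'s partition containing [alpha] can
   contribute to a difference at [alpha]. *)
Lemma combination_triangular q r q' r' alpha :
  admissible q r -> admissible q' r' ->
  (forall beta, mlt le beta alpha -> agree_at q r q' r' beta) ->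
  (forall beta, mlt le beta alpha ->
     digit (combination q r) beta = digit (combination q' r') beta) /\
  (digit (combination q r) alpha = digit (combination q' r') alpha <->
   agree_at q r q' r' alpha).
Proof.
move=> [qD rD] [q'D r'D] agree.
have gecl := translation_closed_le le_order alpha.
have gtcl := translation_closed_mlt le_order alpha.
pose D i := tnth q i - tnth q' i.
have VB : combination q r - combination q' r' =
    \sum_(i < s) D i * tnth F i + (r - r').
  rewrite /combination opprD addrACA -sumrB; congr (_ + _).
  by apply: eq_bigr => i _; rewrite mulrBl.
have sum_closed i : translation_closed [set gamma | le alpha (gamma + e i)].
  by move=> b c /= leb; rewrite addrAC; apply: (gecl _ _ leb).
have sum_closed' i : translation_closed [set gamma | mlt le alpha (gamma + e i)].
  by move=> b c /= leb; rewrite addrAC; apply: (gtcl _ _ leb).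
have notle b : ~ le alpha b -> mlt le b alpha by rewrite mltNge // => /negP.
have Dge i gamma : ~ le alpha (gamma + e i) -> digit (D i) gamma = 0.
  move: gamma; apply: (proj1 (digitB ds _ _ (sum_closed i))) => gamma /= /notle lt.
  by have [+ _] := agree _ lt; apply.
have Tge i : supported digit [set b | le alpha b] (D i * tnth F i).
  by apply: (supported_term (alpha := alpha)) => // [gamma /Dge //|b /mltW].
have rge : supported digit [set b | le alpha b] (r - r').
  apply: (proj1 (digitB ds _ _ gecl)) => b /= /notle lt.
  by have [_ +] := agree _ lt.
have notlt b : ~ mlt le alpha b -> b = alpha \/ mlt le b alpha.
  move=> /negP; rewrite mltNge // negbK le_eqVmlt // => /orP[/eqP|]; by [left|right].
have Tgt i : (forall gamma, gamma + e i = alpha ->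
      digit (tnth q i) gamma = digit (tnth q' i) gamma) ->
    supported digit [set b | mlt le alpha b] (D i * tnth F i).
  move=> eqi; apply: (supported_term (alpha := alpha)) => // [gamma|gamma /mltW //].
  move: gamma; apply: (proj1 (digitB ds _ _ (sum_closed' i))) => gamma /=.
  move/notlt=> [/eqi //|lt].
  by have [+ _] := agree _ lt; apply.
have rgt : digit r alpha = digit r' alpha ->
    supported digit [set b | mlt le alpha b] (r - r').
  move=> eqr; apply: (proj1 (digitB ds _ _ gtcl)) => b /= /notlt[-> //|lt].
  by have [_ +] := agree _ lt.
split.
  move=> beta lt; apply: (proj2 (digitB ds _ _ gecl)); last first.
    by apply/negP; rewrite -mltNge.
  by rewrite VB; apply: (supportedD ds gecl) => //; apply: (supported_sum ds gecl).
split=> [Veq|[eqq eqr]]; last first.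
  apply: (proj2 (digitB ds _ _ gtcl)); last by rewrite /= mltxx.
  by rewrite VB; apply: (supportedD ds gtcl); [apply: (supported_sum ds gtcl) => i _|];
    [apply: Tgt; apply: eqq|apply: rgt].
(* Equal digits at and below [alpha] mean that the difference of the combinations is supported
   strictly above [alpha]. *)
have Vgt : supported digit [set b | mlt le alpha b]
    (\sum_(i < s) D i * tnth F i + (r - r')).
  apply: (supported_mlt le_mono).
    by apply: (supportedD ds gecl) => //; apply: (supported_sum ds gecl).
  rewrite -VB; apply: (proj1 (digitB ds _ _ gtcl)) => [b /= /notlt[-> //|lt]|].
    apply: (proj2 (digitB ds _ _ gecl)); last by apply/negP; rewrite -mltNge.
    by rewrite VB; apply: (supportedD ds gecl) => //; apply: (supported_sum ds gecl).
  by rewrite /= mltxx.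
(* Off its own block, admissibility forces the digit of each quotient to be zero on both sides. *)
have outside (i : 'I_s) : ~ DeltaF i alpha -> forall gamma, gamma + e i = alpha ->
    digit (tnth q i) gamma = digit (tnth q' i) gamma.
  move=> nD gamma ga.
  have -> : digit (tnth q i) gamma = 0.
    by apply/eqP; apply: contraT => /qD; rewrite ga.
  by apply/esym/eqP; apply: contraT => /q'D; rewrite ga.
have [[j Dj]|nD] := pselect (exists j : 'I_s, DeltaF j alpha); last first.
  have eqq i : forall gamma, gamma + e i = alpha ->
      digit (tnth q i) gamma = digit (tnth q' i) gamma.
    by apply: outside => Di; apply: nD; exists i.
  split=> [//|].
  (* No quotient differs at [alpha], so r - r' is the total difference minus terms supported
     strictly above [alpha]. *)
  suff r_gt : supported digit [set b | mlt le alpha b] (r - r').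
    by apply: (proj2 (digitB ds _ _ gtcl)) r_gt _ _; rewrite /= mltxx.
  rewrite -[r - r'](addKr (\sum_(i < s) D i * tnth F i)) addrC.
  apply: (supportedB ds gtcl) => //; apply: (supported_sum ds gtcl) => i _.
  by apply: Tgt; apply: eqq.
have eqq i : i != j -> forall gamma, gamma + e i = alpha ->
    digit (tnth q i) gamma = digit (tnth q' i) gamma.
  by move=> nij; apply: outside => /(Delta_F_disjoint Dj) ij; rewrite ij eqxx in nij.
have eqr : digit r alpha = digit r' alpha.
  have -> : digit r alpha = 0.
    by apply/eqP; apply: contraT => /rD/Delta_barE/(_ j).
  by apply/esym/eqP; apply: contraT => /r'D/Delta_barE/(_ j).
split=> // i gamma; have [->{i}|/eqq] := eqVneq i j; last exact.
(* All other terms lie strictly above [alpha], hence so does [D j * tnth F j]. A differing digit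
   would make [gamma] the leading exponent of [D j], and [digit_leadM] would produce a nonzero digit
   at gamma + e j = alpha. *)
move=> ga; apply/eqP; apply: contraT => neq.
have Tjgt : supported digit [set b | mlt le alpha b] (D j * tnth F j).
  have -> : D j * tnth F j = (\sum_(i < s) D i * tnth F i + (r - r')) -
      (\sum_(i < s | i != j) D i * tnth F i + (r - r')).
    by rewrite (bigD1 j) //= -[_ + (r - r')]addrA addrK.
  apply: (supportedB ds gtcl) => //; apply: (supportedD ds gtcl); last exact: rgt.
  by apply: (supported_sum ds gtcl) => i nij; apply: Tgt; apply: eqq.
have Dj_ge : supported digit [set b | le gamma b] (D j).
  by move=> b /= nle; apply: Dge; rewrite -ga leD2r.
have Dj_gamma : digit (D j) gamma != 0.
  apply: contra neq => /eqP D0; apply/eqP.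
  apply: (proj2 (digitB ds _ _ (translation_closed_mlt le_order gamma))).
    by apply: (supported_mlt le_mono).
  by rewrite /= mltxx.
have [Fj Fj_ge] := proj1 (LM_SomeP ds le_mono _ _) (LM_F j).
have /negP := digit_leadM ds le_mono Dj_ge Fj_ge Dj_gamma Fj.
by rewrite ga Tjgt //= mltxx.
Qed.

(** Well-founded induction on the exponent: agreement below [alpha] and equal combinations force
    agreement at [alpha]. *)
Lemma admissible_unique q r q' r' : admissible q r -> admissible q' r' ->
  combination q r = combination q' r' -> q = q' /\ r = r'.
Proof.
move=> adm adm' eqV.
have agree alpha : agree_at q r q' r' alpha.
  elim/(well_founded_ind (mlt_wf le_order)): alpha => alpha IH.
  by have [_ <-] := combination_triangular adm adm' IH; rewrite eqV.
split; last by apply: (digit_inj ds) => alpha; case: (agree alpha).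
apply: eq_from_tnth => i; apply: (digit_inj ds) => gamma.
by case: (agree (gamma + e i)) => + _; apply.
Qed.

Lemma admissible_exists f : exists q r, admissible q r /\ f = combination q r.
Proof.
have /choice[mk mkP] := digit_surj ds.
pose q h : s.-tuple R := [tuple mk (fun gamma =>
  if `[<DeltaF i (gamma + e i)>] then h (gamma + e i) else 0) | i < s].
pose r h := mk (fun alpha => if `[<Delta_bar iota x le F alpha>] then h alpha else 0).
have adm h : admissible (q h) (r h).
  split=> [i gamma|alpha]; rewrite ?tnth_mktuple mkP; case: asboolP => //;
    by rewrite eqxx.
(* The blocks partition N^n: the one containing [alpha] reads off [h alpha], and all other digits
   compared at [alpha] are zero. *)
have agreeP h h' alpha : agree_at (q h) (r h) (q h') (r h') alpha <-> h alpha = h' alpha.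
  rewrite /agree_at; split=> [[eqq]|eqh].
    rewrite !mkP; case: asboolP => [//|nbar _].
    have [i Di] : exists i : 'I_s, DeltaF i alpha.
      by apply: contrapT => nD; apply/nbar/Delta_barE => i Di; apply: nD; exists i.
    have [gamma ga] := Delta_F_shift Di.
    have := eqq i gamma (esym ga); rewrite !tnth_mktuple !mkP -ga.
    by case: asboolP.
  by split=> [i gamma ga|]; rewrite ?tnth_mktuple !mkP ?ga eqh.
have [|h hf] := triangular_surjective (0 : k) (mlt_wf le_order)
  (Phi := fun h => digit (combination (q h) (r h))) _ (digit f).
  move=> alpha h h' eqh; apply: iff_trans (agreeP h h' alpha).
  have below beta : mlt le beta alpha -> agree_at (q h) (r h) (q h') (r h') beta.
    by move/eqh/agreeP.
  by case: (combination_triangular (adm h) (adm h') below).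
by exists (q h), (r h); split=> //; apply: (digit_inj ds) => alpha; rewrite hf.
Qed.

(** Comparison with the zero data: by triangularity, the least exponent at which the data do not
    agree with zero is the leading monomial of the combination, and every single term is supported
    at or above it. *)
Lemma LM_combination q r (i : 'I_s) : admissible q r ->
  le_infty le (LM iota x le (combination q r)) (LM iota x le (tnth q i * tnth F i)).
Proof.
move=> adm; pose q0 : s.-tuple R := [tuple 0 | i < s].
have adm0 : admissible q0 0.
  by split=> [j gamma|alpha]; rewrite ?tnth_mktuple (digit0 ds) eqxx.
have comb0 : combination q0 0 = 0.
  by rewrite /combination addr0 big1 // => j _; rewrite tnth_mktuple mul0r.
case LMi: (LM _ _ _ (_ * _)) => [b|]; last by case: (LM _ _ _ _).
(* If the data agree with zero everywhere, the i-th quotient vanishes, contradicting the finite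
   leading monomial of its product with f_i. *)
have [all0|] := pselect (forall alpha, agree_at q r q0 0 alpha).
  suff qi0 : tnth q i = 0 by rewrite qi0 mul0r (LM0 ds le_mono) in LMi.
  apply: (digit_eq0 ds) => gamma; have [/(_ i gamma erefl) -> _] := all0 (gamma + e i).
  by rewrite tnth_mktuple (digit0 ds).
case/existsNP => alpha0 /(mlt_minimal le_order (P := fun a => ~ agree_at _ _ _ _ a)).
case=> alpha [nagree below].
have {}below beta : mlt le beta alpha -> agree_at q r q0 0 beta.
  by move=> /below/contrapT.
have [Vbelow Valpha] := combination_triangular adm adm0 below.
have -> : LM iota x le (combination q r) = Some alpha.
  apply/(LM_SomeP ds le_mono); split.
    apply/eqP => V0; apply: nagree; apply/Valpha.
    by rewrite V0 comb0 (digit0 ds).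
  move=> c /= /negP; rewrite -mltNge // => /Vbelow ->.
  by rewrite comb0 (digit0 ds).
have [ti _] := proj1 (LM_SomeP ds le_mono _ _) LMi.
apply: contraT => /negP nle; apply: contraTT ti => _; rewrite negbK; apply/eqP.
suff: supported digit [set c | le alpha c] (tnth q i * tnth F i) by apply.
apply: (supported_term (alpha := alpha)) => //; first exact: translation_closed_le.
  move=> gamma /= /negP; rewrite -mltNge // => /below[/(_ i gamma erefl) -> _].
  by rewrite tnth_mktuple (digit0 ds).
by move=> c /mltW.
Qed.

End Division.

Theorem theorem5p3 (p n s : nat) (k : finFieldType) (R : unitRingType)
    (iota : k -> R) (x : n.-tuple R)
    (HR : case_A p iota x \/ case_B p iota x)
    (le : rel (mindex n)) (Hle : monomial_order iota x le)
    (F : s.-tuple R) (HF : forall i : 'I_s, tnth F i != 0) (f : R) :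
  (exists! qr : s.-tuple R * R, is_division iota x le F f qr.1 qr.2) /\
  (forall (q : s.-tuple R) (r : R), is_division iota x le F f q r ->
     forall i : 'I_s,
       le_infty le (LM iota x le f)
                   (LM iota x le (tnth q i * tnth F i))).
Proof.
have [digit ds] := digit_system_exists HR.
have [e LM_F] := LM_divisors ds Hle HF.
have divE := is_divisionE ds LM_F.
split.
  have [q [r [adm ->]]] := admissible_exists ds Hle LM_F f.
  exists (q, r); split=> [|[q' r'] /= /divE[eqV adm']]; first exact/divE.
  by have [-> ->] := admissible_unique ds Hle LM_F adm adm' eqV.
by move=> q r /divE[-> adm] i; apply: (LM_combination ds Hle LM_F).
Qed.
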